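(* Let $U\in C^2(\mathbb T)$ be a real-valued shear profile with zero mean, and let $\beta>0$ and $\nu>0$ be fixed. Then for all sufficiently small $\varepsilon>0$ (depending on $U,\beta,\nu$), the principal eigenvalue $\lambda^{(0)}_{\nu,\varepsilon,\beta}$ of $\mathcal L_{\nu,\varepsilon,\beta}$ satisfies $\mathrm{Re}\,\lambda^{(0)}_{\nu,\varepsilon,\beta}<0$.
   Context: $\mathbb T=\mathbb R/2\pi\mathbb Z$. For $\nu,\varepsilon,\beta>0$, the operator $\mathcal L_{\nu,\varepsilon,\beta}:H^2(\mathbb T)\subset L^2(\mathbb T)\to L^2(\mathbb T)$ is $$\mathcal L_{\nu,\varepsilon,\beta}:=\nu(\partial_{yy}-\varepsilon^2)-\mathrm i\,\varepsilon\Big(U(y)-(U''(y)-\beta)(\partial_{yy}-\varepsilon^2)^{-1}\Big),$$ where $U(y)$ and $U''(y)-\beta$ act by multiplication. For fixed $U,\beta,\nu$ and all sufficiently small $\varepsilon>0$, the operator $\mathcal L_{\nu,\varepsilon,\beta}$ has exactly one spectral point, a simple eigenvalue, in the disc of radius $\nu/2$ centered at $-\nu\varepsilon^2+\frac{\mathrm i\beta}{\varepsilon}$; this is the principal eigenvalue $\lambda^{(0)}_{\nu,\varepsilon,\beta}$. *)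

(* Defs.v *)
From HB Require Import structures.
From mathcomp Require Import all_boot all_order all_algebra.
From mathcomp Require Import all_classical all_reals all_analysis.
From mathcomp Require Import complex.
Set Implicit Arguments.
Unset Strict Implicit.
Unset Printing Implicit Defensive.
Import Order.TTheory GRing.Theory Num.Theory.
Import numFieldNormedType.Exports.
Local Open Scope classical_set_scope.
Local Open Scope ring_scope.
Local Open Scope complex_scope.

(* Functions on the torus T = R / 2 pi Z are 2pi-periodic functions on R, and
   elements of L^2(T) are such functions up to equality almost everywhere;
   integrals over T are Lebesgue integrals over [0, 2pi] (not normalized). *)
Definition periodic2pi {R : realType} {V : Type} (f : R -> V) : Prop :=
  forall y, f (y + 2 * pi) = f y.

Definition period {R : realType} : set R := `[0, 2 * pi].

Definition eq_ae {R : realType} (f g : R -> R[i]) : Prop :=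
  {ae @lebesgue_measure R, forall y, f y = g y}.

Definition sqmod {R : realType} (z : R[i]) : R :=
  complex.Re z ^+ 2 + complex.Im z ^+ 2.

Definition cintegral {R : realType} (f : R -> R[i]) : R[i] :=
  Complex (\int[@lebesgue_measure R]_(y in period) complex.Re (f y))
          (\int[@lebesgue_measure R]_(y in period) complex.Im (f y)).

Definition L2T {R : realType} (f : R -> R[i]) : Prop :=
  [/\ periodic2pi f,
      measurable_fun setT (fun y => complex.Re (f y)),
      measurable_fun setT (fun y => complex.Im (f y)) &
      (\int[@lebesgue_measure R]_(y in period) (sqmod (f y))%:E < +oo)%E].

Definition L2norm {R : realType} (f : R -> R[i]) : R :=
  Num.sqrt (\int[@lebesgue_measure R]_(y in period) sqmod (f y)).

Definition C1T {R : realType} (phi : R -> R) : Prop :=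
  [/\ periodic2pi phi, (forall y, derivable phi y 1) & continuous (derive1 phi)].

Definition C2T {R : realType} (U : R -> R) : Prop := C1T U /\ C1T (derive1 U).

(* Real test functions suffice, by linearity; there is no boundary term
   because f, g and phi are all periodic. *)
Definition weak_derivative {R : realType} (f g : R -> R[i]) : Prop :=
  forall phi : R -> R, C1T phi ->
    cintegral (fun y => f y * (derive1 phi y)%:C) =
    - cintegral (fun y => g y * (phi y)%:C).

(* Unbounded operators on L^2(T) are given by their graphs: A f g reads
   "f belongs to the domain of A and A f = g in L^2(T)". *)
Definition operator (R : realType) := (R -> R[i]) -> (R -> R[i]) -> Prop.

(* d^2/dy^2 with domain H^2(T) *)
Definition Dyy {R : realType} : operator R := fun f f2 =>
  exists f1, [/\ L2T f, L2T f1, L2T f2, weak_derivative f f1 &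
                 weak_derivative f1 f2].

(* d^2/dy^2 - eps^2 with domain H^2(T); for eps <> 0 it is a bijection from
   H^2(T) onto L^2(T). *)
Definition helmholtz {R : realType} (eps : R) : operator R := fun f g =>
  L2T g /\ exists2 f2, Dyy f f2 &
    eq_ae g (fun y => f2 y - (eps ^+ 2)%:C * f y).

Definition inverse {R : realType} (A : operator R) : operator R :=
  fun f g => A g f.

Definition Lop {R : realType} (U : R -> R) (nu eps beta : R) : operator R :=
  fun f g => L2T g /\
    exists h phi, [/\ helmholtz eps f h, inverse (helmholtz eps) f phi &
      eq_ae g (fun y => nu%:C * h y
        - Complex 0 eps * ((U y)%:C * f y - (derive1n 2 U y - beta)%:C * phi y))].

(* A - lam, with the domain of A *)
Definition shift {R : realType} (A : operator R) (lam : R[i]) : operator R :=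
  fun f h => A f (fun y => h y + lam * f y).

(* A - lam is a bijection from its domain onto L^2(T) with bounded inverse. *)
Definition resolvent_set {R : realType} (A : operator R) : set R[i] :=
  [set lam | [/\
    forall f, shift A lam f (fun=> 0) -> eq_ae f (fun=> 0),
    forall h, L2T h -> exists f, shift A lam f h &
    exists M : R, forall f h, shift A lam f h -> L2norm f <= M * L2norm h]].

Definition spectrum {R : realType} (A : operator R) : set R[i] :=
  ~` resolvent_set A.

(* the kernel of (A - lam)^n *)
Fixpoint ker_pow {R : realType} (A : operator R) (lam : R[i]) (n : nat)
    (f : R -> R[i]) : Prop :=
  if n is m.+1 then exists2 h, shift A lam f h & ker_pow A lam m h
  else eq_ae f (fun=> 0).

(* Algebraic simplicity: the generalized eigenspace, i.e., the union of the
   kernels of the powers of A - lam, is a line spanned by an eigenfunction. *)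
Definition simple_eigenvalue {R : realType} (A : operator R) (lam : R[i]) :
    Prop :=
  exists f, [/\ ~ eq_ae f (fun=> 0), shift A lam f (fun=> 0) &
    forall n g, ker_pow A lam n g -> exists c, eq_ae g (fun y => c * f y)].

Definition principal_disc {R : realType} (nu eps beta : R) : set R[i] :=
  [set lam | `|lam - Complex (- nu * eps ^+ 2) (beta / eps)| < (nu / 2)%:C].

(* The conditions determine lam, since spectrum and disc meet only at lam. *)
Definition principal_eigenvalue {R : realType} (U : R -> R)
    (nu eps beta : R) (lam : R[i]) : Prop :=
  spectrum (Lop U nu eps beta) `&` principal_disc nu eps beta = [set lam] /\
  simple_eigenvalue (Lop U nu eps beta) lam.

(* Main.v *)
Require Import Defs.
From HB Require Import structures.
From mathcomp Require Import all_boot all_order all_algebra.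
From mathcomp Require Import all_classical all_reals all_analysis.
From mathcomp Require Import complex.
From mathcomp Require Import measurable_realfun ring lra.
Import Order.TTheory GRing.Theory Num.Theory.
Import numFieldNormedType.Exports.
Local Open Scope classical_set_scope.
Local Open Scope ring_scope.

(** Let f be an eigenfunction for lam and phi = (dyy - eps^2)^-1 f. Write
    f = f0 + g and phi = phi0 + psi with f0, phi0 the means, and put
    mu = lam + nu eps^2 - i beta / eps, so that |mu| < nu / 2. Since
    phi0 = - f0 / eps^2, the eigenvalue equation becomes
      mu f + i (beta / eps) g
        = nu f'' - i eps (U (f0 + g) - (U'' - beta) psi) - (i / eps) U'' f0.
    In the product with i g the term f'' disappears because <f'', g> is real,
    and for small eps the term (beta / eps) |g|^2 beats all the others except
    U'' f0 / eps; hence |g| <= C |f0|, and |psi| <= C' |f0| by Poincare's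
    inequality. In particular f0 <> 0. In the product with f0 the means of U g
    and U'' psi nearly cancel, as g = psi'' - eps^2 psi gives
    int U g - int U'' psi = - eps^2 int U psi; therefore Re mu = O(eps^3) and
    Re lam = Re mu - nu eps^2 < 0.

    The products are computed on real and imaginary parts. Integration by parts
    of weak derivatives follows from Fubini's theorem once weakly differentiable
    functions are known to be primitives. *)

(** * Integrals over a period *)

Notation integrableT p :=
  ((@lebesgue_measure _).-integrable period (EFin \o p)) (only parsing).

Section IntegralOverPeriod.
Context {R : realType}.
Implicit Types p q r u w : R -> R.
Notation mu := (@lebesgue_measure R).
Notation "\intT p" := (\int[mu]_(y in period) p y) (at level 10, p at level 9).

Lemma pi2_gt0 : 0 < 2 * pi :> R.
Proof. by rewrite mulr_gt0 ?pi_gt0. Qed.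

Lemma ae_imp (P Q : R -> Prop) : {ae mu, forall y, P y} ->
  (forall y, P y -> Q y) -> {ae mu, forall y, Q y}.
Proof. by move=> aeP PQ; exact: (@filterS _ _ (ae_filter_ringOfSetsType mu) _ _ PQ). Qed.

Lemma ae_and (P Q : R -> Prop) : {ae mu, forall y, P y} ->
  {ae mu, forall y, Q y} -> {ae mu, forall y, P y /\ Q y}.
Proof. exact: (@filterI _ _ (ae_filter_ringOfSetsType mu)). Qed.

Lemma measurable_period : measurable (period : set (measurableTypeR R)).
Proof. exact: measurable_itv. Qed.

Lemma period_measure : mu period = (2 * pi)%:E.
Proof.
by rewrite /period lebesgue_measure_itv /= lte_fin pi2_gt0 -EFinB subr0.
Qed.

Lemma Rintegral_period_cst (c : R) : \int[mu]_(y in period) c = 2 * pi * c.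
Proof.
rewrite (Rintegral_cst mu measurable_period) mulrC; congr (_ * _).
exact: (congr1 fine period_measure).
Qed.

Lemma integrableT_measurable p : integrableT p -> measurable_fun period p.
Proof. by case/integrableP => /measurable_EFinP. Qed.

Lemma integrableT_cst (c : R) : integrableT (fun=> c).
Proof.
apply: measurable_bounded_integrable.
- exact: measurable_period.
- by rewrite [ltLHS]period_measure ltry.
- exact: measurable_cst.
- by exists `|c|; split => // x /ltW cx y _ /=.
Qed.

Lemma integrableTD p q :
  integrableT p -> integrableT q -> integrableT (fun y => p y + q y).
Proof. by move=> ip iq; have := integrableD measurable_period ip iq. Qed.

Lemma integrableTB p q :
  integrableT p -> integrableT q -> integrableT (fun y => p y - q y).
Proof. by move=> ip iq; have := integrableB measurable_period ip iq. Qed.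

Lemma integrableTZ c p : integrableT p -> integrableT (fun y => c * p y).
Proof. by move=> ip; have := integrableZl measurable_period c ip. Qed.

Lemma RintegralTD p q : integrableT p -> integrableT q ->
  \intT (fun y => p y + q y) = \intT p + \intT q.
Proof. by move=> ip iq; rewrite RintegralD//; exact: measurable_period. Qed.

Lemma RintegralTB p q : integrableT p -> integrableT q ->
  \intT (fun y => p y - q y) = \intT p - \intT q.
Proof. by move=> ip iq; rewrite RintegralB//; exact: measurable_period. Qed.

Lemma RintegralTZ c p : integrableT p ->
  \intT (fun y => c * p y) = c * \intT p.
Proof. by move=> ip; rewrite RintegralZl//; exact: measurable_period. Qed.

Lemma ae_eq_RintegralT p q : measurable_fun period p ->
  measurable_fun period q -> {ae mu, forall y, period y -> p y = q y} ->
  \intT p = \intT q.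
Proof.
move=> mp mq pq; congr fine; apply: ae_eq_integral.
- exact: measurable_period.
- exact/measurable_EFinP.
- exact/measurable_EFinP.
- by apply: (ae_imp _ _ pq) => y {}pq /pq /= ->.
Qed.

(** Replacing [q] by the maximum of [p] and [q], which agrees with [q] almost everywhere on the
    period, turns the inequality into a pointwise one. *)
Lemma ae_le_RintegralT p q : integrableT p -> integrableT q ->
  {ae mu, forall y, period y -> p y <= q y} -> \intT p <= \intT q.
Proof.
move=> ip iq pq.
have mp := integrableT_measurable _ ip; have mq := integrableT_measurable _ iq.
have mmax : measurable_fun period (fun y => Num.max (p y) (q y)).
  exact: measurable_maxr.
have imax : integrableT (fun y => Num.max (p y) (q y)).
  apply: (@le_integrable _ _ _ mu _ measurable_period _
     (EFin \o (fun y => `|p y| + `|q y|))).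
  - exact/measurable_EFinP.
  - move=> y _ /=; rewrite lee_fin (@ger0_norm _ (_ + _)) ?addr_ge0//.
    by rewrite maxEle; case: ifP => _; rewrite ?lerDr ?lerDl.
  - by apply: integrableTD; exact: integrable_norm.
rewrite (_ : \intT q = \intT (fun y => Num.max (p y) (q y))).
  by apply: le_Rintegral => //; [exact: measurable_period|
    move=> y _; rewrite le_max lexx].
apply: ae_eq_RintegralT => //.
by apply: (ae_imp _ _ pq) => y {}pq /pq /max_idPr.
Qed.

(** Real L^2 over one period. Measurability is a separate clause because measurability of the square
    says nothing about the sign of [p]. *)
Definition sqintegrable p :=
  measurable_fun period p /\ integrableT (fun y => p y ^+ 2).

Lemma sqintegrable_mul p q : sqintegrable p -> sqintegrable q ->
  integrableT (fun y => p y * q y).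
Proof.
move=> [mp ip] [mq iq].
apply: (@le_integrable _ _ _ mu _ measurable_period _
     (EFin \o (fun y => p y ^+ 2 + q y ^+ 2))).
- exact/measurable_EFinP/measurable_funM.
- move=> y _ /=; rewrite lee_fin (@ger0_norm _ (_ + _)) ?addr_ge0 ?sqr_ge0//.
  by rewrite ler_norml; apply/andP; split; nra.
- exact: integrableTD.
Qed.

Lemma sqintegrable_cst (c : R) : sqintegrable (fun=> c).
Proof. by split; [exact: measurable_cst|exact: integrableT_cst]. Qed.

Lemma sqintegrable_integrable p : sqintegrable p -> integrableT p.
Proof.
move=> sp; have := sqintegrable_mul _ _ sp (sqintegrable_cst 1).
by congr (mu.-integrable _ _); apply/funext => y /=; rewrite mulr1.
Qed.

Lemma sqintegrableZ c p : sqintegrable p -> sqintegrable (fun y => c * p y).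
Proof.
move=> [mp ip]; split; first exact: measurable_funM.
have := integrableTZ (c ^+ 2) _ ip.
by congr (mu.-integrable _ _); apply/funext => y /=; rewrite exprMn.
Qed.

Lemma sqintegrableD p q : sqintegrable p -> sqintegrable q ->
  sqintegrable (fun y => p y + q y).
Proof.
move=> sp sq; have ipq := sqintegrable_mul _ _ sp sq.
move: sp sq => [mp ip] [mq iq]; split; first exact: measurable_funD.
have := integrableTD _ _ (integrableTD _ _ ip iq) (integrableTZ 2 _ ipq).
by congr (mu.-integrable _ _); apply/funext => y /=; congr EFin; ring.
Qed.

Lemma sqintegrableB p q : sqintegrable p -> sqintegrable q ->
  sqintegrable (fun y => p y - q y).
Proof.
move=> sp sq; have := sqintegrableD _ _ sp (sqintegrableZ (-1) _ sq).
by congr sqintegrable; apply/funext => y; rewrite mulN1r.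
Qed.

Lemma continuous_bounded_period (V : R -> R) : continuous V ->
  exists M, 0 < M /\ forall y, period y -> `|V y| <= M.
Proof.
move=> cV; have cVn : continuous (fun y => `|V y|).
  by move=> y; apply: continuous_comp; [exact: cV|exact: norm_continuous].
have [c _ cM] := EVT_max (ltW pi2_gt0) (continuous_subspaceT cVn).
(* Adding 1 keeps the bound positive even for [V = 0]; the bound on the profile is later used as a
   divisor. *)
exists (`|V c| + 1); split => [|y py]; first by rewrite ltr_wpDl.
by rewrite (le_trans (cM y py))// lerDl.
Qed.

Lemma sqintegrableM p (V : R -> R) : sqintegrable p -> continuous V ->
  sqintegrable (fun y => V y * p y).
Proof.
move=> [mp ip] cV.
have mV : measurable_fun period V.
  by apply: measurable_funTS; exact: continuous_measurable_fun.
split; first exact: measurable_funM.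
have := @integrableMr _ _ _ mu _ measurable_period _ _ (measurable_funM mV mV) _ ip.
have bV : [bounded V x * V x : R^o | x in (period : set R)].
  have [M [_ VM]] := continuous_bounded_period _ cV.
  exists (M * M); split => [|x MMx y py /=]; first exact: num_real.
  by rewrite (le_trans _ (ltW MMx))// normrM ler_pM ?VM.
by move/(_ bV); congr (mu.-integrable _ _); apply/funext => y /=;
  rewrite -EFinM; congr EFin; ring.
Qed.

End IntegralOverPeriod.

(** * Fubini's theorem on a triangle *)

Section Triangle.
Context {R : realType}.
Implicit Types p q r u w : R -> R.
Notation mu := (@lebesgue_measure R).
Notation "\intT p" := (\int[mu]_(y in period) p y) (at level 10, p at level 9).

Lemma periodE (y : R) : period y <-> 0 <= y <= 2 * pi.
Proof. by rewrite /period /= in_itv. Qed.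

(** The base point is 0 and the intended arguments lie in the period; for [y < 0] the interval is
    empty and the value is 0. *)
Definition primitive0 u (y : R) : R := \int[mu]_(t in `[0, y]) u t.

Lemma subset_period (s : R) : period s -> `[0, s]%classic `<=` (period : set R).
Proof.
move=> /periodE /andP[_ s2] y /=; rewrite in_itv /= => /andP[y0 ys].
by apply/periodE; rewrite y0 (le_trans ys).
Qed.

Lemma primitive0_continuous u : integrableT u ->
  {within `[0, 2 * pi], continuous (primitive0 u)}.
Proof. by move=> iu; exact: parameterized_integral_continuous (ltW pi2_gt0) iu. Qed.

Lemma within_continuous_sqintegrable p :
  {within `[0, 2 * pi], continuous p} -> sqintegrable p.
Proof.
move=> cp; split.
  exact: (subspace_continuous_measurable_fun (measurable_itv _) cp).
apply: continuous_compact_integrable; first exact: segment_compact.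
by move=> x; apply: cvgM; exact: cp.
Qed.

Lemma integrable_primitive0M u w : integrableT u -> integrableT w ->
  integrableT (fun s => primitive0 u s * w s).
Proof.
move=> iu iw; have cu := primitive0_continuous _ iu.
have [mP _] := within_continuous_sqintegrable _ cu.
have bP : [bounded primitive0 u x : R^o | x in (period : set R)].
  have := continuous_compact cu (@segment_compact _ 0 (2 * pi)).
  move=> /compact_bounded [M [Mr MP]]; exists M; split => // x Mx y py.
  by apply: MP => //; exists y.
have := @integrableMr _ _ _ mu _ (@measurable_period R) _ _ mP bP iw.
by congr (mu.-integrable _ _).
Qed.

(** The two terms on the left integrate u(t) w(s) over the triangles t <= s and s <= t, which
    together fill the square. This is integration by parts for two primitives that vanish at 0. *)
Lemma Fubini_triangle u w : integrableT u -> integrableT w ->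
  \intT (fun s => primitive0 u s * w s) + \intT (fun s => primitive0 w s * u s) =
  \intT u * \intT w.
Proof.
move=> iu iw; have mD := @measurable_period R.
pose u' := u \_ period; pose w' := w \_ period.
have iu' : mu.-integrable setT (EFin \o u').
  by rewrite /u' -restrict_EFin; apply/(integrable_mkcond _ mD).
have iw' : mu.-integrable setT (EFin \o w').
  by rewrite /w' -restrict_EFin; apply/(integrable_mkcond _ mD).
have mu' : measurable_fun setT u' by case/integrableP: iu' => /measurable_EFinP.
have mw' : measurable_fun setT w' by case/integrableP: iw' => /measurable_EFinP.
(* The product cut off to the triangle t <= s, with s = [x.1] and t = [x.2]; extension by zero
   allows Fubini on the whole plane. *)
pose h (x : measurableTypeR R * measurableTypeR R) : R :=
  if x.2 <= x.1 then w' x.1 * u' x.2 else 0.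
have mle (f g : measurableTypeR R * measurableTypeR R -> R) :
    measurable_fun setT f -> measurable_fun setT g ->
    measurable_fun setT (fun x => f x <= g x).
  exact: measurable_fun_ler.
have mw1 : measurable_fun setT
    (fun x : measurableTypeR R * measurableTypeR R => w' x.1).
  exact: measurableT_comp mw' measurable_fst.
have mu2 : measurable_fun setT
    (fun x : measurableTypeR R * measurableTypeR R => u' x.2).
  exact: measurableT_comp mu' measurable_snd.
have mprod : measurable_fun setT
    (fun x : measurableTypeR R * measurableTypeR R => w' x.1 * u' x.2).
  exact: measurable_funM.
have mh : measurable_fun setT h.
  apply: measurable_fun_ifT => //.
  by apply: mle; [exact: measurable_snd|exact: measurable_fst].
have iprod : (mu \x mu)%E.-integrable setT
    (EFin \o (fun x : measurableTypeR R * measurableTypeR R => w' x.1 * u' x.2)).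
  (* By Tonelli, the iterated integral of the absolute value is the product of two finite L^1
     norms. *)
  apply/integrable12ltyP; first exact/measurable_EFinP.
  have -> : (\int[mu]_x \int[mu]_y `|(w' x * u' y)%:E| =
     \int[mu]_x ((fine (\int[mu]_y `|(u' y)%:E|))%:E * `|(w' x)%:E|))%E.
    apply: eq_integral => x _.
    under eq_integral do rewrite EFinM abseM.
    rewrite ge0_integralZl//; last first.
      by apply: measurableT_comp => //; exact/measurable_EFinP.
    rewrite fineK 1?muleC// ge0_fin_numE; last exact: integral_ge0.
    by case/integrableP: iu'.
  rewrite ge0_integralZl//; last 2 first.
    by apply: measurableT_comp => //; exact/measurable_EFinP.
    by rewrite lee_fin fine_ge0// integral_ge0.
  by case/integrableP: iw' => _ ?; rewrite lte_mul_pinfty// lee_fin fine_ge0// integral_ge0.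
have ih : (mu \x mu)%E.-integrable setT (EFin \o h).
  apply: (le_integrable measurableT _ _ iprod); first exact/measurable_EFinP.
  by move=> x _ /=; rewrite lee_fin /h; case: ifP => // _; rewrite normr0.
have := Fubini ih.
(* Inner integrals of [h] in the two orders, up to a factor: [P] integrates [u'] up to s, [Q]
   integrates [w'] from t on. *)
pose P s := \int[mu]_t (if t <= s then u' t else 0).
pose Q t := \int[mu]_s (if t <= s then w' s else 0).
have Pfin s : mu.-integrable setT (EFin \o (fun t => if t <= s then u' t else 0)).
  apply: (le_integrable measurableT _ _ iu'); last first.
    by move=> x _ /=; rewrite lee_fin; case: ifP => // _; rewrite normr0.
  apply/measurable_EFinP; apply: measurable_fun_ifT => //.
  exact: measurable_fun_ler.
have Qfin t : mu.-integrable setT (EFin \o (fun s => if t <= s then w' s else 0)).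
  apply: (le_integrable measurableT _ _ iw'); last first.
    by move=> x _ /=; rewrite lee_fin; case: ifP => // _; rewrite normr0.
  apply/measurable_EFinP; apply: measurable_fun_ifT => //.
  exact: measurable_fun_ler.
have -> : (\int[mu]_x \int[mu]_y (EFin \o h) (x, y) =
    \int[mu]_x (P x * w' x)%:E)%E.
  apply: eq_integral => s _; rewrite mulrC -RintegralZl// /Rintegral fineK.
    by apply: eq_integral => t _ /=; rewrite /h /=; case: ifP => // _; rewrite mulr0.
  apply: integrable_fin_num => //.
  exact: (integrableZl measurableT (w' s) (Pfin s)).
have -> : (\int[mu]_y \int[mu]_x (EFin \o h) (x, y) =
    \int[mu]_y (Q y * u' y)%:E)%E.
  apply: eq_integral => t _; rewrite mulrC -RintegralZl// /Rintegral fineK.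
    apply: eq_integral => s _ /=; rewrite /h /=; case: ifP => // _; last by rewrite mulr0.
    by rewrite mulrC.
  apply: integrable_fin_num => //.
  exact: (integrableZl measurableT (u' t) (Qfin t)).
move=> /(congr1 fine); rewrite -/(Rintegral _ _ _) -/(Rintegral _ _ _) => PQ.
have PE s : period s -> P s = primitive0 u s.
  move=> ps; rewrite /primitive0 Rintegral_mkcond; apply: eq_Rintegral => t _.
  rewrite /u' !patchE; case: ifPn => ts.
    case: ifPn => [|tD].
      rewrite inE => /periodE /andP[t0 _].
      by rewrite ifT// inE /= in_itv /= t0.
    rewrite ifF//; apply: contraNF tD; rewrite !inE; exact: subset_period.
  by rewrite ifF//; apply: contraNF ts; rewrite inE /= in_itv /= => /andP[].
(* Integrating from t to the end of the period gives the total minus the primitive; this is where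
   the product of the two integrals comes from. *)
have QE t : period t -> primitive0 w t = \intT w - Q t.
  move=> pt; move/periodE : (pt) => /andP[t0 t2].
  have -> : Q t = \int[mu]_(s in `]t, 2 * pi]) w s.
    rewrite Rintegral_itv_obnd_cbnd; last first.
      apply: (integrableS mD) => //= s /=.
      by rewrite /period /= !in_itv /= => /andP[/ltW/(le_trans t0) -> ->].
    rewrite Rintegral_mkcond; apply: eq_Rintegral => s _.
    rewrite /w' !patchE; case: ifPn => ts.
      case: ifPn => [|tD].
        rewrite inE => /periodE /andP[_ s2].
        by rewrite ifT// inE /= in_itv /= s2 andbT.
      rewrite ifF//; apply: contraNF tD; rewrite !inE /= in_itv /= => /andP[_ s2].
      by apply/periodE; rewrite (le_trans t0 ts).
    by rewrite ifF//; apply: contraNF ts; rewrite inE /= in_itv /= => /andP[].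
  rewrite /period -(@Rintegral_itvB _ w (BLeft 0) (BRight (2 * pi)) t)//.
  by rewrite subKr.
have iP : integrableT (fun s => P s * w s).
  move: (integrable_primitive0M _ _ iu iw); apply: eq_integrable => //.
  by move=> s; rewrite inE /= => /PE ->.
have iQ : integrableT (fun s => Q s * u s).
  move: (integrableTB _ _ (integrableTZ (\intT w) _ iu)
    (integrable_primitive0M _ _ iw iu)); apply: eq_integrable => //.
  by move=> s; rewrite inE /= => /QE ->; rewrite mulrBl subKr.
have -> : \intT (fun s => primitive0 u s * w s) = \intT (fun s => P s * w s).
  by apply: eq_Rintegral => s; rewrite inE => /PE ->.
have -> : \intT (fun s => primitive0 w s * u s) =
    \intT (fun s => \intT w * u s - Q s * u s).
  by apply: eq_Rintegral => s; rewrite inE => /QE ->; rewrite mulrBl.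
rewrite RintegralTB ?RintegralTZ//; last exact: integrableTZ.
have -> : \intT (fun s => P s * w s) = \intT (fun s => Q s * u s).
  rewrite !(Rintegral_mkcond mu period).
  transitivity (\int[mu]_x (P x * w' x)).
    by apply: eq_Rintegral => s _; rewrite /w' !patchE; case: ifP => // _; rewrite mulr0.
  rewrite PQ.
  by apply: eq_Rintegral => s _; rewrite /u' !patchE; case: ifP => // _; rewrite mulr0.
by rewrite addrC subrK mulrC.
Qed.

End Triangle.

(** * Primitives of periodic functions *)

Section PeriodicPrimitive.
Context {R : realType}.
Implicit Types p q r u w : R -> R.
Notation mu := (@lebesgue_measure R).
Notation "\intT p" := (\int[mu]_(y in period) p y) (at level 10, p at level 9).

Lemma continuous_sqintegrable p : continuous p -> sqintegrable p.
Proof.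
by move=> cp; apply: within_continuous_sqintegrable; exact: continuous_subspaceT.
Qed.

Lemma continuous_integrable_itv (eta : R -> R) (a b : R) : continuous eta ->
  mu.-integrable `[a, b] (EFin \o eta).
Proof.
move=> ceta; apply: continuous_compact_integrable; first exact: segment_compact.
exact: continuous_subspaceT.
Qed.

(** The signed integral from 0 works: near [y] it differs by a constant from the integral based at
    [- K] with [K > |y|], and there [y] lies to the right of the base point, as the fundamental
    theorem of calculus requires. *)
Lemma exists_primitive (eta : R -> R) : continuous eta ->
  exists phi : R -> R, forall y, derivable phi y 1 /\ derive1 phi y = eta y.
Proof.
move=> ceta.
pose phi y := if 0 <= y then \int[mu]_(t in `]0, y]) eta t
              else - \int[mu]_(t in `]y, 0]) eta t.
pose F (K y : R) := \int[mu]_(t in `[- K, y]) eta t.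
have Fder K y : - K < y -> derivable (F K) y 1 /\ derive1 (F K) y = eta y.
  move=> Ky; apply: (@continuous_FTC1 _ eta (BLeft (- K)) y (y + 1)).
  - by rewrite ltrDl.
  - exact: continuous_integrable_itv.
  - by rewrite lte_fin.
  - exact: ceta.
have phiE K y : 0 < K -> - K < y -> F K y - F K 0 = phi y.
  move=> K0 Ky; rewrite /phi /F; case: (leP 0 y) => y0.
    rewrite -(@Rintegral_itvB _ _ (BLeft (- K)) (BRight y) 0) ?bnd_simp ?oppr_le0 ?(ltW K0)//.
    exact: continuous_integrable_itv.
  rewrite -(@Rintegral_itvB _ _ (BLeft (- K)) (BRight 0) y) ?bnd_simp ?ltW//.
    by rewrite opprB.
  exact: continuous_integrable_itv.
exists phi => y; pose K := `|y| + 1.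
have K0 : 0 < K by rewrite /K ltr_wpDl.
have Ky : - K < y by rewrite /K; have := ler_norm (- y); rewrite normrN; lra.
have [dF dFE] := Fder _ _ Ky.
have isF : is_derive y 1 (fun y => F K y - F K 0) (eta y).
  rewrite -[eta y]subr0 -dFE derive1E; apply: is_deriveB.
  by apply: DeriveDef.
have nE : \forall x \near y, F K x - F K 0 = phi x.
  by near=> x; apply: phiE => //; near: x; exact: lt_nbhsr.
have [] := near_eq_is_derive nE isF.
by move=> dphi dE; split; [exact: dphi|rewrite derive1E; exact: dE].
Unshelve. all: by end_near. Qed.

Lemma derivable_continuous (f : R -> R) : (forall y, derivable f y 1) -> continuous f.
Proof.
by move=> df y; apply/differentiable_continuous; rewrite -derivable1_diffP.
Qed.

Lemma primitive0_derive1 (phi : R -> R) (y : R) : (forall y, derivable phi y 1) ->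
  continuous (derive1 phi) -> 0 <= y ->
  primitive0 (derive1 phi) y = phi y - phi 0.
Proof.
move=> dphi cdphi; rewrite le_eqVlt => /predU1P[<-|y0].
  by rewrite /primitive0 set_itv1 Rintegral_set1 subrr.
have cphi := derivable_continuous _ dphi.
have cd : {within `[0, y], continuous (derive1 phi)}.
  exact: continuous_subspaceT.
have dLR : derivable_oo_LRcontinuous phi 0 y.
  split; first by move=> x _; exact: dphi.
    by apply: cvg_at_right_filter; exact: cphi.
  by apply: cvg_at_left_filter; exact: cphi.
have FTC := @continuous_FTC2 R (derive1 phi) phi 0 y y0 cd dLR (fun _ _ => erefl).
by rewrite /primitive0 /Rintegral FTC.
Qed.

(** For a primitive [phi], the difference phi(y + 2 pi) - phi(y) has derivative 0 by periodicity of
    [eta], so it equals its value at 0, which is the integral of [eta] over a period. *)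
Lemma exists_C1T_primitive (eta : R -> R) : continuous eta -> periodic2pi eta ->
  \intT eta = 0 -> exists phi, C1T phi /\ derive1 phi = eta.
Proof.
move=> ceta peta eta0; have [phi phiP] := exists_primitive _ ceta.
have dphi y : derivable phi y 1 by case: (phiP y).
have phiE : derive1 phi = eta by apply/funext => y; case: (phiP y).
exists phi; split; last exact: phiE.
split; [|exact: dphi|by rewrite phiE].
move=> y; apply/eqP; rewrite -subr_eq0; apply/eqP.
have shiftD (x : R) : is_derive x 1 (fun x => phi (x + 2 * pi)) (eta x).
  rewrite -peta -phiE.
  have d1 : is_derive (x + 2 * pi) 1 phi (derive1 phi (x + 2 * pi)).
    by rewrite derive1E; apply: DeriveDef.
  have d2 : is_derive x 1 (fun x : R => x + 2 * pi) 1.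
    by rewrite -[1 in X in is_derive _ _ _ X]addr0; apply: is_deriveD.
  have := @is_derive1_comp _ phi (fun x : R => x + 2 * pi) x _ _ d1 d2.
  by rewrite mulr1.
have -> : phi (y + 2 * pi) - phi y = phi (0 + 2 * pi) - phi 0.
  apply: (@is_derive_0_is_cst _ (fun x => phi (x + 2 * pi) - phi x) y 0) => x.
  rewrite -(subrr (eta x)); apply: is_deriveB.
  by rewrite -phiE derive1E; apply: DeriveDef.
rewrite add0r -(primitive0_derive1 _ (2 * pi)) ?phiE ?(ltW pi2_gt0)//.
Qed.

End PeriodicPrimitive.

(** * Functions orthogonal to all continuous periodic functions *)

Section Orthogonality.
Context {R : realType}.
Implicit Types p q r u w : R -> R.
Notation mu := (@lebesgue_measure R).
Notation "\intT p" := (\int[mu]_(y in period) p y) (at level 10, p at level 9).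

(* For 0 < b < 2 pi, arc b is positive on the period [0, 2 pi] exactly inside
   ]0, b[, so that the periodic functions bump b n tend to the indicator of ]0, b[. *)
Definition arc (b y : R) : R := cos (y - b / 2) - cos (b / 2).

Lemma arcE b y : arc b y = 2 * sin (y / 2) * sin ((b - y) / 2).
Proof.
rewrite /arc; have -> : y - b / 2 = y / 2 - (b - y) / 2 by field.
have -> : b / 2 = y / 2 + (b - y) / 2 by field.
by rewrite cosB cosD; ring.
Qed.

(** In the product form the first sine is positive inside the period, so the sign is that of sin((b
    - y) / 2), whose argument stays in ]-pi, pi[. At 0 and 2 pi the first sine vanishes, hence the
    separate cases. *)
Lemma arc_gt0 b y : 0 < b < 2 * pi -> 0 <= y <= 2 * pi ->
  (0 < arc b y) = (0 < y < b).
Proof.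
move=> /andP[b0 b2] /andP[y0 y2]; rewrite arcE.
move: y0; rewrite le_eqVlt => /predU1P[<-|y0].
  by rewrite mul0r sin0 mulr0 mul0r ltxx.
move: y2; rewrite le_eqVlt => /predU1P[->|y2].
  have -> : 2 * pi / 2 = pi :> R by field.
  by rewrite sinpi mulr0 mul0r ltxx mulr_gt0 ?pi_gt0//= ltNge (ltW b2).
have s0 : 0 < sin (y / 2) by apply: sin_gt0_pi; apply/andP; split; lra.
rewrite pmulr_rgt0 ?mulr_gt0// y0 /=; apply/idP/idP => [|yb].
  apply: contraTT; rewrite -!leNgt => yb.
  rewrite -oppr_ge0 -sinN; apply: sin_ge0_pi; apply/andP; split; lra.
by apply: sin_gt0_pi; apply/andP; split; lra.
Qed.

Definition bump b (n : nat) (y : R) : R :=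
  Num.min 1 (Num.max 0 (n%:R * arc b y)).

Lemma continuous_arc b : continuous (arc b).
Proof.
move=> y; apply: cvgB; last exact: cvg_cst.
apply: (@continuous_comp _ _ _ (fun y : R => y - b / 2) (@cos R)); last exact: continuous_cos.
by apply: cvgB; [exact: cvg_id|exact: cvg_cst].
Qed.

Lemma continuous_bump b n : continuous (bump b n).
Proof.
move=> y; have carc : {for y, continuous (fun y => n%:R * arc b y : R^o)}.
  by apply: cvgM; [exact: cvg_cst|exact: continuous_arc].
have c0 (a : R) : {for y, continuous (fun=> a : R^o)} by exact: cst_continuous.
exact: (continuous_min (c0 1) (continuous_max (c0 0) carc)).
Qed.

Lemma periodic_bump b n : periodic2pi (bump b n).
Proof.
move=> y; rewrite /bump /arc; congr (Num.min 1 (Num.max 0 (_ * (_ - _)))).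
have -> : y + 2 * pi - b / 2 = y - b / 2 + pi *+ 2 by rewrite mulr2n; ring.
exact: cosD2pi.
Qed.

Lemma bump_ge0 b n y : 0 <= bump b n y.
Proof. by rewrite /bump le_min ler01 le_max lexx. Qed.

Lemma bump_le1 b n y : bump b n y <= 1.
Proof. by rewrite /bump ge_min lexx. Qed.

(** Each sequence is eventually constant: where [arc] is positive the cut-off at 1 is active once n
    >= 1 / [arc b y], and elsewhere the cut-off at 0 always is. *)
Lemma bump_cvg b y : bump b n y @[n --> \oo] --> (if 0 < arc b y then 1 else 0 : R).
Proof.
case: ltP => a0; last first.
  apply: cvg_near_cst; near=> n; rewrite /bump max_l ?min_r ?ler01//.
  by rewrite mulr_ge0_le0.
apply: cvg_near_cst; near=> n; rewrite /bump min_l// le_max; apply/orP; right.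
rewrite -ler_pdivrMr// div1r; near: n; exact: nbhs_infty_ger.
Unshelve. all: by end_near. Qed.

(** The functions [bump b n] are admissible [eta]; dominated convergence, with dominating function
    |u|, passes to the indicator of ]0, b[. *)
Lemma Rintegral_initial_eq0 u (b : R) : integrableT u ->
  (forall eta : R -> R, continuous eta -> periodic2pi eta ->
    \intT (fun y => u y * eta y) = 0) ->
  0 < b < 2 * pi -> \int[mu]_(y in `[0, b]) u y = 0.
Proof.
move=> iu u0 b02; have mD := @measurable_period R.
have mu_ := integrableT_measurable _ iu.
pose f_ n y : \bar R := (u y * bump b n y)%:E.
pose f y : \bar R := (u y * (if 0 < arc b y then 1 else 0))%:E.
have mf_ n : measurable_fun period (f_ n).
  apply/measurable_EFinP; apply: measurable_funM => //.
  by apply: measurable_funTS; apply: continuous_measurable_fun; exact: continuous_bump.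
have marc : measurable_fun setT (arc b).
  by apply: continuous_measurable_fun; exact: continuous_arc.
have mf : measurable_fun period f.
  apply/measurable_EFinP; apply: measurable_funM => //; apply: measurable_funTS.
  apply: measurable_fun_ifT; [|exact: measurable_cst|exact: measurable_cst].
  by apply: measurable_fun_ltr => //; exact: measurable_cst.
have ff : {ae mu, forall y, period y -> f_ ^~ y @ \oo --> f y}.
  apply: aeW => y _; apply: cvg_EFin; first exact: nearW.
  by apply: cvgM; [exact: cvg_cst|exact: bump_cvg].
have fg : {ae mu, forall y n, period y -> (`|f_ n y| <= (`|u y|)%:E)%E}.
  apply: aeW => y n _; rewrite /f_ lee_fin normrM (ger0_norm (bump_ge0 _ _ _)).
  by apply: ler_piMr; [exact: normr_ge0|exact: bump_le1].
have [_ _] := @dominated_convergence _ _ _ mu _ mD f_ f (EFin \o (Num.norm \o u))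
  mf_ mf ff (integrable_norm iu) fg.
have fn0 n : (\int[mu]_(x in period) f_ n x = 0)%E.
  have := u0 _ (continuous_bump b n) (periodic_bump b n).
  rewrite /Rintegral => h; rewrite -[LHS]fineK ?h//.
  apply: integrable_fin_num => //; apply: (le_integrable mD (mf_ n) _ iu).
  move=> y _ /=; rewrite lee_fin normrM (ger0_norm (bump_ge0 _ _ _)).
  by apply: ler_piMr; [exact: normr_ge0|exact: bump_le1].
rewrite (_ : [sequence _]_n = cst 0%E); last by apply/funext => n; rewrite /= fn0.
move=> /(cvg_lim (@ereal_hausdorff R)); rewrite lim_cst// => fI.
have pb : period b by apply/periodE; case/andP: b02 => /ltW -> /ltW ->.
have ib : mu.-integrable `[0, b] (EFin \o u).
  by apply: integrableS iu => //; exact: subset_period.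
(* The limit of the bumps lives on the open interval, so both endpoints are removed first. *)
rewrite -Rintegral_itv_bndo_bndc; last first.
  apply: integrableS ib => // x.
  by rewrite /= !in_itv /= => /andP[-> /ltW ->].
rewrite -Rintegral_itv_obnd_cbnd; last first.
  apply: integrableS ib => // x.
  by rewrite /= !in_itv /= => /andP[/ltW -> /ltW ->].
rewrite -[RHS]/(fine 0%E) fI -/(Rintegral mu period _).
rewrite [LHS]Rintegral_mkcond [RHS]Rintegral_mkcond; apply: eq_Rintegral => y _.
rewrite !patchE; case: ifPn => yb; case: ifPn => yD //.
- rewrite arc_gt0//; last by apply/periodE; rewrite inE in yD.
  by move: yb; rewrite inE /= in_itv /= => ->; rewrite mulr1.
- move: yb; rewrite inE /= in_itv /= => /andP[y0 yb].
  case/negP: yD; rewrite inE; apply: (subset_period _ pb).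
  by rewrite /= in_itv /= !ltW.
- rewrite arc_gt0//; last by apply/periodE; rewrite inE in yD.
  by rewrite ifF ?mulr0//; apply: contraNF yb; rewrite inE /= in_itv.
Qed.

Lemma ae_neq (a : R) : {ae mu, forall y, y != a}.
Proof.
exists [set a]; split; [exact: measurable_set1|exact: lebesgue_measure_set1|].
by move=> y /= /negP; rewrite negbK => /eqP.
Qed.

(** The primitive of [u] vanishes at every point of ]0, 2 pi[, so its derivative there is 0; by
    Lebesgue differentiation this derivative is [u] almost everywhere. *)
Lemma ae_eq0_of_orthogonal u : integrableT u ->
  (forall eta : R -> R, continuous eta -> periodic2pi eta ->
    \intT (fun y => u y * eta y) = 0) ->
  {ae mu, forall y, period y -> u y = 0}.
Proof.
move=> iu u0; have mD := @measurable_period R.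
have iu' : mu.-integrable setT (EFin \o (u \_ period)).
  by rewrite -restrict_EFin; apply/(integrable_mkcond _ mD).
have iu0 (y : R) : mu.-integrable `[0, y] (EFin \o (u \_ period)).
  by apply: integrableS iu'.
have := @FTC1 _ (u \_ period) (BLeft 0) iu0 (integrable_locally mD iu).
move=> /ae_and /(_ (ae_neq 0)) /ae_and /(_ (ae_neq (2 * pi))) /ae_imp; apply.
move=> y [[+ y0] y2] /[dup] py /periodE /andP[y0' y2'].
have {}y0 : 0 < y by rewrite lt_neqAle eq_sym y0.
have {}y2 : y < 2 * pi by rewrite lt_neqAle y2.
rewrite lte_fin => /(_ y0) [_]; rewrite patchE mem_set// => <-.
rewrite derive1E; transitivity ('D_1 (cst 0 : R -> R) y); last exact: derive_cst.
apply: near_eq_derive.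
near=> x; have x02 : 0 < x < 2 * pi.
  by apply/andP; split; near: x; [exact: lt_nbhsr|exact: lt_nbhsl].
rewrite -[RHS](Rintegral_initial_eq0 u x iu u0 x02); congr fine.
apply: eq_integral => z.
rewrite inE /= in_itv /= => /andP[z0 zx]; rewrite patchE mem_set//.
apply/periodE; rewrite z0 (le_trans zx)//; case/andP: x02 => _; exact: ltW.
Unshelve. all: by end_near. Qed.

End Orthogonality.

(** * Weak derivatives *)

Section WeakDerivatives.
Context {R : realType}.
Implicit Types p q r u w : R -> R.
Notation mu := (@lebesgue_measure R).
Notation "\intT p" := (\int[mu]_(y in period) p y) (at level 10, p at level 9).

(** The real Sobolev space H^1 of the circle. Test functions are periodic and may be nonzero at 0
    and 2 pi, so the condition also forces the end values of [p] to agree. *)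
Definition weakly_derivable p p1 := [/\ sqintegrable p, sqintegrable p1 &
  forall phi, C1T phi ->
    \intT (fun y => p y * derive1 phi y) = - \intT (fun y => p1 y * phi y)].

Lemma Rintegral_derive1 (phi : R -> R) : C1T phi -> \intT (derive1 phi) = 0.
Proof.
move=> [pphi dphi cdphi].
have := primitive0_derive1 _ (2 * pi) dphi cdphi (ltW pi2_gt0).
by rewrite /primitive0 -/period -[X in phi X - _]add0r pphi subrr.
Qed.

Lemma C1T_cst (c : R) : C1T (fun=> c).
Proof.
split; [by []|by move=> y; exact: derivable_cst|].
rewrite (_ : derive1 _ = fun=> 0); first exact: cst_continuous.
by apply/funext => y; exact: derive1_cst.
Qed.

(** The test function is 1. This weak form of equal end values is what removes boundary terms
    later. *)
Lemma weak_derivative_mean0 p p1 : weakly_derivable p p1 -> \intT p1 = 0.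
Proof.
move=> [_ _ /(_ _ (C1T_cst 1))].
have -> : \intT (fun y => p y * derive1 (fun=> 1 : R) y) = 0.
  rewrite -[RHS](mulr0 (2 * pi)) -Rintegral_period_cst; apply: eq_Rintegral => y _.
  by rewrite derive1_cst mulr0.
move=> /eqP; rewrite eq_sym oppr_eq0 => /eqP <-.
by apply: eq_Rintegral => y _; rewrite mulr1.
Qed.

Lemma weakly_derivableBc p p1 c : weakly_derivable p p1 ->
  weakly_derivable (fun y => p y - c) p1.
Proof.
move=> [sp sp1 wp]; split => //.
  by apply: sqintegrableB => //; exact: sqintegrable_cst.
move=> phi Cphi; rewrite -wp//.
have [_ _ /continuous_sqintegrable sphi] := Cphi.
rewrite -[RHS]subr0 -[X in _ - X](mulr0 c) -(Rintegral_derive1 _ Cphi) -RintegralTZ.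
  rewrite -RintegralTB.
  - by apply: eq_Rintegral => y _; rewrite mulrBl.
  - exact: sqintegrable_mul.
  - by apply: integrableTZ; exact: sqintegrable_integrable.
exact: sqintegrable_integrable.
Qed.

Lemma sqintegrable_primitive0 p : integrableT p -> sqintegrable (primitive0 p).
Proof. by move=> ip; apply: within_continuous_sqintegrable; exact: primitive0_continuous. Qed.

(* Du Bois-Reymond: the difference with the primitive, minus its mean, is
   orthogonal to every continuous periodic function. *)
Lemma weakly_derivable_primitive p p1 : weakly_derivable p p1 ->
  exists c, {ae mu, forall y, period y -> p y = c + primitive0 p1 y}.
Proof.
move=> wd; have p10 := weak_derivative_mean0 _ _ wd; have [sp sp1 wp] := wd.
have ip := sqintegrable_integrable _ sp; have ip1 := sqintegrable_integrable _ sp1.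
have sP := sqintegrable_primitive0 _ ip1.
have iP := sqintegrable_integrable _ sP.
(* The constant is chosen so that [v] below has mean zero. *)
pose c := (2 * pi)^-1 * (\intT p - \intT (primitive0 p1)); exists c.
pose v y := p y - primitive0 p1 y - c.
have sv : sqintegrable v.
  by apply: sqintegrableB; [exact: sqintegrableB|exact: sqintegrable_cst].
have iv := sqintegrable_integrable _ sv.
have v0 : \intT v = 0.
  rewrite /v RintegralTB//; [|exact: integrableTB|exact: integrableT_cst].
  rewrite RintegralTB// Rintegral_period_cst /c mulrA divff ?mul1r ?subrr//.
  by rewrite gt_eqF// pi2_gt0.
suff : {ae mu, forall y, period y -> v y = 0}.
  by move=> /ae_imp; apply=> y + py => /(_ py); rewrite /v => /eqP;
    rewrite subr_eq0 subr_eq addrC => /eqP.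
apply: ae_eq0_of_orthogonal => // eta ceta peta.
(* Without its mean, [eta] is the derivative of a periodic C^1 function, which can serve as a test
   function. *)
pose m := (2 * pi)^-1 * \intT eta.
have seta := continuous_sqintegrable _ ceta.
have cem : continuous (fun y => eta y - m).
  by move=> y; apply: cvgB; [exact: ceta|exact: cvg_cst].
have [||phi [Cphi phiE]] := exists_C1T_primitive (fun y => eta y - m) cem.
- by move=> y; rewrite peta.
- rewrite RintegralTB ?Rintegral_period_cst;
    [|exact: sqintegrable_integrable|exact: integrableT_cst].
  by rewrite /m mulrA divff ?mul1r ?subrr// gt_eqF// pi2_gt0.
have [pphi dphi cdphi] := Cphi.
have sdphi := continuous_sqintegrable _ cdphi.
have sphi := continuous_sqintegrable _ (derivable_continuous _ dphi).
have dphi0 := Rintegral_derive1 _ Cphi.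
(* Integration by parts for the primitive of [p1] against [phi]; the boundary term vanishes because
   [p1] has mean zero. *)
have tri := Fubini_triangle _ _ ip1 (sqintegrable_integrable _ sdphi).
rewrite p10 mul0r in tri.
have pd : \intT (fun s => primitive0 (derive1 phi) s * p1 s) = \intT (fun y => p1 y * phi y).
  transitivity (\intT (fun y => p1 y * phi y) - phi 0 * \intT p1); last first.
    by rewrite p10 mulr0 subr0.
  rewrite -RintegralTZ//.
  rewrite -RintegralTB; [|exact: sqintegrable_mul|exact: integrableTZ].
  apply: eq_Rintegral => y; rewrite inE => /periodE /andP[y0 _].
  by rewrite primitive0_derive1//; ring.
(* Substituting eta = phi' + m leaves the weak derivative identity, the triangle identity, and two
   terms that integrate to 0. *)
have -> : \intT (fun y => v y * eta y) =
    \intT (fun y => (p y * derive1 phi y - primitive0 p1 y * derive1 phi y) -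
       (c * derive1 phi y - m * v y)).
  by apply: eq_Rintegral => y _; rewrite phiE /v /=; ring.
have isd := sqintegrable_integrable _ sdphi.
rewrite RintegralTB; last 2 first.
- by apply: integrableTB; exact: sqintegrable_mul.
- by apply: integrableTB; exact: integrableTZ.
rewrite !RintegralTB ?RintegralTZ//; try exact: sqintegrable_mul; try exact: integrableTZ.
by rewrite v0 dphi0 !mulr0 !subr0 wp// -pd; move/eqP: tri; rewrite addrC addr_eq0 => /eqP ->;
  rewrite opprK subrr.
Qed.

Lemma RintegralM_primitive p p1 u : weakly_derivable p p1 -> sqintegrable u ->
  \intT u = 0 -> \intT (fun y => p y * u y) = \intT (fun y => primitive0 p1 y * u y).
Proof.
move=> wp su u0; have [c pE] := weakly_derivable_primitive _ _ wp.
have [sp sp1 _] := wp.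
have iu := sqintegrable_integrable _ su.
have sP := sqintegrable_primitive0 _ (sqintegrable_integrable _ sp1).
have iPu := sqintegrable_mul _ _ sP su.
transitivity (\intT (fun y => c * u y + primitive0 p1 y * u y)).
  apply: ae_eq_RintegralT.
  - by apply: integrableT_measurable; exact: sqintegrable_mul.
  - by apply: integrableT_measurable; apply: integrableTD => //; exact: integrableTZ.
  - by apply: (ae_imp _ _ pE) => y {}pE /pE ->; rewrite mulrDl.
by rewrite RintegralTD ?RintegralTZ ?u0 ?mulr0 ?add0r//; exact: integrableTZ.
Qed.

(** Both functions are primitives up to constants, and these drop out against derivatives of mean
    zero. The triangle identity then applies, with vanishing product of means. *)
Lemma weak_integration_by_parts p p1 q q1 :
  weakly_derivable p p1 -> weakly_derivable q q1 ->
  \intT (fun y => p y * q1 y) = - \intT (fun y => q y * p1 y).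
Proof.
move=> wp wq; have p0 := weak_derivative_mean0 _ _ wp.
have q0 := weak_derivative_mean0 _ _ wq.
have [_ sp1 _] := wp; have [_ sq1 _] := wq.
rewrite (RintegralM_primitive _ _ _ wp)// (RintegralM_primitive _ _ _ wq)//.
have := Fubini_triangle _ _ (sqintegrable_integrable _ sp1) (sqintegrable_integrable _ sq1).
by rewrite p0 mul0r => /eqP; rewrite addr_eq0 => /eqP.
Qed.

(** Cauchy-Schwarz against the constant 1, read off from the nonnegative integral of (p - m)^2 with
    [m] the mean of [p]. *)
Lemma sqr_Rintegral_le p : sqintegrable p ->
  (\intT p) ^+ 2 <= 2 * pi * \intT (fun y => p y ^+ 2).
Proof.
move=> sp; have ip := sqintegrable_integrable _ sp; case: (sp) => _ ip2.
pose m := (2 * pi)^-1 * \intT p.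
have : 0 <= \intT (fun y => (p y ^+ 2 - 2 * m * p y) + m ^+ 2).
  apply: Rintegral_ge0 => y _.
  by rewrite (_ : _ + _ = (p y - m) ^+ 2) ?sqr_ge0//; ring.
rewrite RintegralTD; [|by apply: integrableTB => //; exact: integrableTZ
  |exact: integrableT_cst].
rewrite RintegralTB//; last exact: integrableTZ.
rewrite RintegralTZ// Rintegral_period_cst.
have pi0 := @pi2_gt0 R; set A := \intT p; set B := \intT (fun y => p y ^+ 2).
have mA : A = 2 * pi * m by rewrite /m mulrA divff ?mul1r ?gt_eqF.
rewrite mA => h; have := mulr_ge0 (ltW pi0) h.
by rewrite -subr_ge0; congr (0 <= _); ring.
Qed.

Lemma sqr_norm_sqintegrable p : sqintegrable p -> sqintegrable (fun y => `|p y|).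
Proof.
move=> [mp ip]; split; first exact: measurableT_comp.
by move: ip; congr (mu.-integrable _ _); apply/funext => y /=; rewrite real_normK ?num_real.
Qed.

Lemma primitive0_le u y : integrableT u -> period y ->
  `|primitive0 u y| <= \intT (fun y => `|u y|).
Proof.
move=> iu py; have iy : mu.-integrable `[0, y] (EFin \o u).
  by apply: (integrableS measurable_period _ _ iu) => //; exact: subset_period.
apply: le_trans (le_normr_Rintegral _ iy) _ => //.
have /andP[y0 y2] : 0 <= y <= 2 * pi by apply/periodE.
rewrite -subr_ge0 /period.
rewrite (@Rintegral_itvB _ _ (BLeft 0) (BRight (2 * pi)) y)//.
  exact: Rintegral_ge0.
exact: integrable_norm.
Qed.

(** Since [p] has mean zero, subtracting a constant only increases its L^2 norm; with the constant
    of the primitive representation, p - c is bounded by the L^1 norm of [p1], and Cauchy-Schwarz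
    finishes. The constant is not sharp. *)
Lemma Poincare p p1 : weakly_derivable p p1 -> \intT p = 0 ->
  \intT (fun y => p y ^+ 2) <= (2 * pi) ^+ 2 * \intT (fun y => p1 y ^+ 2).
Proof.
move=> wp p0; have [sp sp1 _] := wp; case: (sp) => mp ip2.
have [c pE] := weakly_derivable_primitive _ _ wp.
have ip := sqintegrable_integrable _ sp; have ip1 := sqintegrable_integrable _ sp1.
set A := \intT (fun y => `|p1 y|).
have A2 : A ^+ 2 <= 2 * pi * \intT (fun y => p1 y ^+ 2).
  have := sqr_Rintegral_le _ (sqr_norm_sqintegrable _ sp1).
  congr (_ <= _ * _); apply: eq_Rintegral => y _; by rewrite real_normK ?num_real.
apply: (@le_trans _ _ (\intT (fun y => (p y ^+ 2 - 2 * c * p y) + c ^+ 2))).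
  rewrite RintegralTD; [|by apply: integrableTB => //; exact: integrableTZ
    |exact: integrableT_cst].
  rewrite RintegralTB//; last exact: integrableTZ.
  rewrite RintegralTZ// Rintegral_period_cst p0 mulr0 subr0 lerDl.
  by rewrite mulr_ge0 ?sqr_ge0 ?ltW ?pi2_gt0.
apply: (@le_trans _ _ (\intT (fun=> A ^+ 2))).
  apply: ae_le_RintegralT.
  - apply: integrableTD; last exact: integrableT_cst.
    by apply: integrableTB => //; exact: integrableTZ.
  - exact: integrableT_cst.
  - apply: (ae_imp _ _ pE) => y {}pE py; have := primitive0_le _ _ ip1 py.
    rewrite (_ : _ + _ = (p y - c) ^+ 2); last by ring.
    rewrite pE// addrC addKr -/A => PA.
    by rewrite -[_ ^+ 2]real_normK ?num_real// lerXn2r ?nnegrE// (le_trans _ PA).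
rewrite Rintegral_period_cst; apply: le_trans (ler_wpM2l (ltW pi2_gt0) A2) _.
by rewrite [leLHS]mulrA -[X in X * _]expr2.
Qed.

(** Pairing p = q'' - eps^2 q with [q] controls the norm of q', hence that of [q] by Poincare. The
    mean-zero assumption makes the constant independent of [eps]; on constants the inverse has size
    eps^-2. *)
Lemma helmholtz_bound (eps : R) p q q1 q2 :
  weakly_derivable q q1 -> weakly_derivable q1 q2 -> \intT q = 0 ->
  sqintegrable p -> {ae mu, forall y, period y -> p y = q2 y - eps ^+ 2 * q y} ->
  \intT (fun y => q y ^+ 2) <= (2 * pi) ^+ 4 * \intT (fun y => p y ^+ 2).
Proof.
move=> wq wq1 q0 sp pE; have [sq sq1 _] := wq; have [_ sq2 _] := wq1.
have ibp := weak_integration_by_parts _ _ _ _ wq wq1.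
have P := Poincare _ _ wq q0.
have pq : \intT (fun y => p y * q y) =
    - \intT (fun y => q1 y ^+ 2) - eps ^+ 2 * \intT (fun y => q y ^+ 2).
  have -> : \intT (fun y => q1 y ^+ 2) = \intT (fun y => q1 y * q1 y).
    by apply: eq_Rintegral => y _; rewrite expr2.
  rewrite -ibp -RintegralTZ; last by case: sq.
  rewrite -RintegralTB; last 2 first.
  - exact: sqintegrable_mul.
  - by apply: integrableTZ; case: sq.
  apply: ae_eq_RintegralT.
  - by apply: integrableT_measurable; exact: sqintegrable_mul.
  - apply: integrableT_measurable; apply: integrableTB; first exact: sqintegrable_mul.
    by apply: integrableTZ; case: sq.
  - by apply: (ae_imp _ _ pE) => y {}pE /pE ->; ring.
(* [k] is the Poincare constant. Expanding (q + k p)^2 >= 0 gives at most one copy of the norm of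
   [q] on the right, against two copies on the left from 2 k |q'|^2. *)
pose k : R := (2 * pi) ^+ 2; have k0 : 0 <= k by rewrite sqr_ge0.
have -> : (2 * pi) ^+ 4 = k ^+ 2 :> R by rewrite /k -exprM.
have : - (2 * k) * \intT (fun y => p y * q y) <=
    \intT (fun y => q y ^+ 2) + k ^+ 2 * \intT (fun y => p y ^+ 2).
  case: (sp) => _ ip2; case: (sq) => _ iq2; have ipq := sqintegrable_mul _ _ sp sq.
  rewrite -!RintegralTZ// -RintegralTD//; last exact: integrableTZ.
  apply: ae_le_RintegralT; [exact: integrableTZ| |].
    by apply: integrableTD => //; exact: integrableTZ.
  apply: aeW => y _; rewrite -subr_ge0.
  by rewrite (_ : _ - _ = (q y + k * p y) ^+ 2) ?sqr_ge0//; ring.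
rewrite pq; move: P; rewrite -/k.
set I1 := \intT (fun y => q1 y ^+ 2); set I0 := \intT (fun y => q y ^+ 2).
have : 0 <= eps ^+ 2 * I0.
  by rewrite mulr_ge0 ?sqr_ge0//; apply: Rintegral_ge0 => y _; exact: sqr_ge0.
move=> /(mulr_ge0 k0); nra.
Qed.

End WeakDerivatives.

(** * Energy estimates *)

Section Energy.
Context {R : realType}.
Implicit Types p q r s U V : R -> R.
Notation mu := (@lebesgue_measure R).
Notation "\intT p" := (\int[mu]_(y in period) p y) (at level 10, p at level 9).

(* Below a + i b is lam + nu eps^2 - i beta / eps, x + i y is the mean of the
   eigenfunction f, p + i q = f - (x + i y), r + i s is the mean-free part of
   (dyy - eps^2)^-1 f, p2 + i q2 = f'' and V = U''. *)

(* Imaginary part of the product of the equation with p - i q; the cross terms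
   are split by Young's inequality, with weight k for those containing x, y. *)
Lemma energy_pointwise (a b nu eps beta M k x y U V p q p2 q2 r s : R) :
  0 < eps -> 0 < beta -> 0 < k -> 0 <= M -> - (nu / 2) <= b ->
  `|U| <= M -> `|V| <= M ->
  a * (p + x) - b * (q + y) - beta / eps * q =
    nu * p2 + eps * (U * q + U * y - (V - beta) * s) + eps^-1 * V * y ->
  a * (q + y) + b * (p + x) + beta / eps * p =
    nu * q2 - eps * (U * p + U * x - (V - beta) * r) - eps^-1 * V * x ->
  (beta / eps - nu / 2) * (p ^+ 2 + q ^+ 2) +
    ((a * y + b * x) * p + (b * y - a * x) * q) + nu * (p2 * q - q2 * p) <=
  (eps * M + (eps * M + eps^-1 * M) * (k / 2) + eps * (M + beta) / 2) *
    (p ^+ 2 + q ^+ 2) +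
  (eps * (M + beta) / 2 * (r ^+ 2 + s ^+ 2) +
   (eps * M + eps^-1 * M) / (2 * k) * (x ^+ 2 + y ^+ 2)).
Proof.
move=> eps0 beta0 k0 M0 hb UM VM E1 E2.
set G := p ^+ 2 + q ^+ 2.
pose W1 := x * p + y * q; pose W2 := r * p + s * q.
have einv : 0 < eps^-1 by rewrite invr_gt0.
have G0 : 0 <= G by rewrite addr_ge0 ?sqr_ge0.
(* The second equation times [p] minus the first times [q]; the products a p q cancel. *)
have key : (beta / eps + b) * G + ((a * y + b * x) * p + (b * y - a * x) * q) +
    nu * (p2 * q - q2 * p) =
    - eps * U * G - (eps * U + eps^-1 * V) * W1 + eps * (V - beta) * W2.
  have := congr1 (fun z => z * p) E2; have := congr1 (fun z => z * q) E1.
  by rewrite /G /W1 /W2 /= => e1 e2; lra.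
have W1le : `|W1| <= k / 2 * G + (x ^+ 2 + y ^+ 2) / (2 * k).
  have sq (c d : R) : `|c * d| <= k / 2 * d ^+ 2 + c ^+ 2 / (2 * k).
    have e (z : R) : z ^+ 2 = c ^+ 2 ->
        k / 2 * d ^+ 2 + c ^+ 2 / (2 * k) - z * d = (k * d - z) ^+ 2 / (2 * k).
      by move=> <-; field; rewrite gt_eqF.
    rewrite ler_norml; apply/andP; split.
      rewrite lerNl -subr_ge0 -mulNr e ?sqrrN//.
      by rewrite divr_ge0 ?sqr_ge0// mulr_ge0 ?ltW.
    by rewrite -subr_ge0 e// divr_ge0 ?sqr_ge0// mulr_ge0 ?ltW.
  apply: le_trans (ler_normD _ _) _; have := lerD (sq x p) (sq y q).
  by rewrite /G => /le_trans; apply; rewrite le_eqVlt; apply/orP; left; apply/eqP; ring.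
have W2le : `|W2| <= (G + (r ^+ 2 + s ^+ 2)) / 2.
  rewrite ler_norml /W2 /G; apply/andP; split.
    by have := sqr_ge0 (r + p); have := sqr_ge0 (s + q); lra.
  by have := sqr_ge0 (r - p); have := sqr_ge0 (s - q); lra.
have bnd (c m z w : R) : `|c| <= m -> `|z| <= w -> c * z <= m * w.
  move=> cm zw; apply: le_trans (ler_norm _) _.
  by rewrite normrM ler_pM.
have B1 : - eps * U * G <= eps * M * G.
  rewrite ler_wpM2r// mulNr -mulrN ler_pM2l//.
  by apply: le_trans UM; rewrite -normrN ler_norm.
have B2 := bnd (- (eps * U + eps^-1 * V)) (eps * M + eps^-1 * M) _ _ _ W1le.
have B3 := bnd (eps * (V - beta)) (eps * (M + beta)) _ _ _ W2le.

have h2 : `|- (eps * U + eps^-1 * V)| <= eps * M + eps^-1 * M.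
  rewrite normrN; apply: le_trans (ler_normD _ _) _.
  by rewrite !normrM (gtr0_norm eps0) (gtr0_norm einv) lerD// ler_pM2l.
have h3 : `|eps * (V - beta)| <= eps * (M + beta).
  rewrite normrM (gtr0_norm eps0) ler_pM2l//; apply: le_trans (ler_normB _ _) _.
  by rewrite lerD// gtr0_norm.
move: (B2 h2) (B3 h3) => {}B2 {}B3.
have hbG : (beta / eps - nu / 2) * G <= (beta / eps + b) * G.
  by rewrite ler_wpM2r// lerD2l.
have R2 : (eps * M + eps^-1 * M) * (k / 2 * G + (x ^+ 2 + y ^+ 2) / (2 * k)) =
  (eps * M + eps^-1 * M) * (k / 2) * G +
  (eps * M + eps^-1 * M) / (2 * k) * (x ^+ 2 + y ^+ 2) by ring.
rewrite R2 in B2; lra.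
Qed.

(** Integrating the pointwise inequality removes the terms linear in [p] and [q] and the one with
    second derivatives, while [r] and [s] are controlled by the Helmholtz bound. After
    multiplication by [eps], half of the leading coefficient [beta] survives. *)
Lemma energy_bound (a b nu eps beta M x y : R) (U V p q p2 q2 r s : R -> R) :
  0 < eps <= 1 -> 0 < beta -> 0 < M -> - (nu / 2) <= b ->
  eps * (nu / 2 + M + (M + beta) * (1 + (2 * pi) ^+ 4) / 2) <= beta / 4 ->
  0 < nu ->
  (forall t, period t -> `|U t| <= M) -> (forall t, period t -> `|V t| <= M) ->
  sqintegrable p -> sqintegrable q -> sqintegrable p2 -> sqintegrable q2 ->
  sqintegrable r -> sqintegrable s ->
  \intT p = 0 -> \intT q = 0 ->
  \intT (fun t => p2 t * q t) = \intT (fun t => q2 t * p t) ->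
  \intT (fun t => r t ^+ 2) <= (2 * pi) ^+ 4 * \intT (fun t => p t ^+ 2) ->
  \intT (fun t => s t ^+ 2) <= (2 * pi) ^+ 4 * \intT (fun t => q t ^+ 2) ->
  {ae mu, forall t, period t ->
    a * (p t + x) - b * (q t + y) - beta / eps * q t =
      nu * p2 t + eps * (U t * q t + U t * y - (V t - beta) * s t)
      + eps^-1 * V t * y /\
    a * (q t + y) + b * (p t + x) + beta / eps * p t =
      nu * q2 t - eps * (U t * p t + U t * x - (V t - beta) * r t)
      - eps^-1 * V t * x} ->
  \intT (fun t => p t ^+ 2) + \intT (fun t => q t ^+ 2) <=
    16 * pi * M ^+ 2 / beta ^+ 2 * (x ^+ 2 + y ^+ 2).
Proof.
move=> /andP[eps0 eps1] beta0 M0 hb heps nu0 UM VM sp sq sp2 sq2 sr ss p0 q0 pq rp sq' E.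
(* With this weight the Young term of order 1 / eps, multiplied by [eps], costs (eps^2 + 1) beta / 8
   <= beta / 4; the smallness assumption on [eps] pays for the rest with another beta / 4. *)
pose k := beta / (4 * M).
have k0 : 0 < k by rewrite divr_gt0// mulr_gt0.
have ip := sqintegrable_integrable _ sp; have iq := sqintegrable_integrable _ sq.
have [_ ipp] := sp; have [_ iqq] := sq; have [_ irr] := sr; have [_ iss] := ss.
have ip2q := sqintegrable_mul _ _ sp2 sq; have iq2p := sqintegrable_mul _ _ sq2 sp.
set Ip := \intT (fun t => p t ^+ 2); set Iq := \intT (fun t => q t ^+ 2).
set Ir := \intT (fun t => r t ^+ 2) in rp *.
set Is := \intT (fun t => s t ^+ 2) in sq' *.
pose c1 := beta / eps - nu / 2.
pose c2 := eps * M + (eps * M + eps^-1 * M) * (k / 2) + eps * (M + beta) / 2.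
pose c3 := eps * (M + beta) / 2.
pose c4 := (eps * M + eps^-1 * M) / (2 * k) * (x ^+ 2 + y ^+ 2).
have : \intT (fun t => c1 * (p t ^+ 2 + q t ^+ 2) +
    ((a * y + b * x) * p t + (b * y - a * x) * q t) +
    nu * (p2 t * q t - q2 t * p t)) <=
  \intT (fun t => c2 * (p t ^+ 2 + q t ^+ 2) + (c3 * (r t ^+ 2 + s t ^+ 2) + c4)).
  apply: ae_le_RintegralT.
  - apply: integrableTD; last by apply: integrableTZ; exact: integrableTB.
    apply: integrableTD; first by apply: integrableTZ; exact: integrableTD.
    by apply: integrableTD; exact: integrableTZ.
  - apply: integrableTD; first by apply: integrableTZ; exact: integrableTD.
    apply: integrableTD; last exact: integrableT_cst.
    by apply: integrableTZ; exact: integrableTD.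
  - apply: (ae_imp _ _ E) => t {}E pt; have [E1 E2] := E pt.
    by apply: energy_pointwise E1 E2 => //; [exact: ltW|exact: UM|exact: VM].
have iG := integrableTD _ _ ipp iqq; have iH := integrableTD _ _ irr iss.
have iT := integrableTB _ _ ip2q iq2p.
have iZ1 := integrableTZ (a * y + b * x) _ ip.
have iZ2 := integrableTZ (b * y - a * x) _ iq.
rewrite (RintegralTD (fun t => c1 * _ + _)); last 2 first.
- by apply: integrableTD; [exact: integrableTZ|exact: integrableTD].
- exact: integrableTZ.
rewrite (RintegralTD (fun t => c1 * _)); last 2 first.
- exact: integrableTZ.
- exact: integrableTD.
rewrite (RintegralTD _ _ iZ1 iZ2).
rewrite (RintegralTD (fun t => c2 * _)); last 2 first.
- exact: integrableTZ.
- by apply: integrableTD; [exact: integrableTZ|exact: integrableT_cst].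
rewrite (RintegralTD (fun t => c3 * _)); last 2 first.
- exact: integrableTZ.
- exact: integrableT_cst.
rewrite (RintegralTZ c1 _ iG) (RintegralTZ c2 _ iG) (RintegralTZ c3 _ iH).
rewrite (RintegralTZ _ _ ip) (RintegralTZ _ _ iq) (RintegralTZ _ _ iT).
rewrite (RintegralTB _ _ ip2q iq2p) (RintegralTD _ _ ipp iqq) (RintegralTD _ _ irr iss).
rewrite p0 q0 pq subrr !mulr0 !addr0 Rintegral_period_cst -/Ip -/Iq -/Ir -/Is.
set J := Ip + Iq; set X := x ^+ 2 + y ^+ 2 => h.
have J0 : 0 <= J by rewrite addr_ge0// Rintegral_ge0// => t _; exact: sqr_ge0.
have X0 : 0 <= X by rewrite addr_ge0// sqr_ge0.
have rsJ : Ir + Is <= (2 * pi) ^+ 4 * J by rewrite mulrDr lerD.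
have c30 : 0 <= c3 by rewrite /c3 divr_ge0// mulr_ge0 ?ltW// addr_gt0.
have {}h : c1 * J <= c2 * J + (c3 * ((2 * pi) ^+ 4 * J) + 2 * pi * c4).
  by apply: le_trans h _; rewrite lerD2l lerD2r ler_wpM2l.
have {}h := ler_wpM2l (ltW eps0) h.
have e1 : eps * (c1 * J) = beta * J - eps * (nu / 2) * J.
  by rewrite /c1; field; rewrite gt_eqF.
have e4 : eps * (2 * pi * c4) = (eps ^+ 2 + 1) * (4 * pi * M ^+ 2 / beta * X).
  by rewrite /c4 -/X /k; field; rewrite !gt_eqF.
have e2 : eps * (c2 * J) =
    (eps ^+ 2 * M + (eps ^+ 2 + 1) * (beta / 8) + eps ^+ 2 * (M + beta) / 2) * J.
  by rewrite /c2 /k; field; rewrite !gt_eqF.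
have esq : eps ^+ 2 <= eps by rewrite expr2 ler_piMl// ltW.
have pi0 := pi_gt0 R.
have Mb0 : 0 <= M + beta by apply: addr_ge0; exact: ltW.
have X4 : 0 <= 4 * pi * M ^+ 2 / beta * X.
  rewrite mulr_ge0// divr_ge0 ?(ltW beta0)// mulr_ge0 ?sqr_ge0//.
  by rewrite mulr_ge0// ltW.
set K := ((2 * pi) ^+ 4 : R) in heps h *; have K0 : 0 <= K by rewrite exprn_ge0// mulr_ge0 ?ltW.
have e3 : eps * (c3 * (K * J)) = eps ^+ 2 * ((M + beta) * K / 2 * J).
  by rewrite /c3; ring.
have b2 : (eps ^+ 2 + 1) * (4 * pi * M ^+ 2 / beta * X) <= 2 * (4 * pi * M ^+ 2 / beta * X).
  by rewrite ler_wpM2r//; lra.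
have b3 : eps ^+ 2 * ((M + beta) * K / 2 * J) <= eps * ((M + beta) * K / 2 * J).
  by rewrite ler_wpM2r//; do 2 (apply: mulr_ge0 => //); exact: mulr_ge0.
have b4 : eps ^+ 2 * (M * J) <= eps * (M * J) by rewrite ler_wpM2r// mulr_ge0// (ltW M0).
have b5 : eps ^+ 2 * ((M + beta) / 2 * J) <= eps * ((M + beta) / 2 * J).
  by rewrite ler_wpM2r// mulr_ge0// divr_ge0.
have b6 : (eps ^+ 2 + 1) * (beta / 8 * J) <= 2 * (beta / 8 * J).
  by rewrite ler_wpM2r//; [rewrite mulr_ge0// divr_ge0// ltW|lra].
have b7 := ler_wpM2r J0 heps.
have fin : beta / 2 * J <= 2 * (4 * pi * M ^+ 2 / beta * X).
  have : eps * (c1 * J) <= eps * (c2 * J) + (eps * (c3 * (K * J)) + eps * (2 * pi * c4)).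
    by rewrite -!mulrDr.
  by rewrite e1 e2 e3 e4; lra.
have -> : 16 * pi * M ^+ 2 / beta ^+ 2 * X = (beta / 2)^-1 * (2 * (4 * pi * M ^+ 2 / beta * X)).
  by field; rewrite gt_eqF.
by rewrite ler_pdivlMl// divr_gt0.
Qed.

(** In the mean of the equation, the pairings of [U] with [q] and of [V] with [s] (likewise [p] and
    [r]) agree up to a factor eps^2. With the prefactor [eps] this leaves eps^3, and Young's
    inequality does the rest. *)
Lemma mean_bound (a b nu eps beta M x y : R)
    (U U1 V p q p2 q2 r r1 r2 s s1 s2 : R -> R) :
  0 < eps -> 0 < M ->
  weakly_derivable U U1 -> weakly_derivable U1 V ->
  continuous U -> continuous V -> (forall t, period t -> `|U t| <= M) ->
  sqintegrable p -> sqintegrable q -> sqintegrable p2 -> sqintegrable q2 ->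
  weakly_derivable r r1 -> weakly_derivable r1 r2 ->
  weakly_derivable s s1 -> weakly_derivable s1 s2 ->
  \intT p = 0 -> \intT q = 0 -> \intT p2 = 0 -> \intT q2 = 0 ->
  \intT r = 0 -> \intT s = 0 ->
  {ae mu, forall t, period t -> p t = r2 t - eps ^+ 2 * r t} ->
  {ae mu, forall t, period t -> q t = s2 t - eps ^+ 2 * s t} ->
  {ae mu, forall t, period t ->
    a * (p t + x) - b * (q t + y) - beta / eps * q t =
      nu * p2 t + eps * (U t * q t + U t * y - (V t - beta) * s t)
      + eps^-1 * V t * y /\
    a * (q t + y) + b * (p t + x) + beta / eps * p t =
      nu * q2 t - eps * (U t * p t + U t * x - (V t - beta) * r t)
      - eps^-1 * V t * x} ->
  2 * pi * a * (x ^+ 2 + y ^+ 2) <= eps ^+ 3 * (M / 2) *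
    (2 * pi * (x ^+ 2 + y ^+ 2) +
     (\intT (fun t => r t ^+ 2) + \intT (fun t => s t ^+ 2))).
Proof.
move=> eps0 M0 wU wU1 cU cV UM sp sq sp2 sq2 wr wr1 ws ws1 p0 q0 p20 q20 r0 s0 pE qE E.
have [sr _ _] := wr; have [ss _ _] := ws.
have [_ sr2 _] := wr1; have [_ ss2 _] := ws1.
have int (f : R -> R) (sf : sqintegrable f) := sqintegrable_integrable f sf.
have ip := int _ sp; have iq := int _ sq; have ip2 := int _ sp2; have iq2 := int _ sq2.
have ir := int _ sr; have is' := int _ ss.
have iM (f W : R -> R) : continuous W -> sqintegrable f -> integrableT (fun t => W t * f t).
  by move=> cW sf; apply: int; exact: sqintegrableM.
(* Two integrations by parts move both derivatives of [f2] onto [U]. *)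
have dual (f f1 f2 g : R -> R) : weakly_derivable f f1 -> weakly_derivable f1 f2 ->
    sqintegrable g ->
    {ae mu, forall t, period t -> g t = f2 t - eps ^+ 2 * f t} ->
    \intT (fun t => U t * g t) =
    \intT (fun t => V t * f t) - eps ^+ 2 * \intT (fun t => U t * f t).
  move=> wf wf1 sg gE; have [sf _ _] := wf; have [_ sf2 _] := wf1.
  have -> : \intT (fun t => V t * f t) = \intT (fun t => U t * f2 t).
    rewrite (weak_integration_by_parts _ _ _ _ wU wf1).
    have -> : \intT (fun t => V t * f t) = \intT (fun t => f t * V t).
      by apply: eq_Rintegral => t _; exact: mulrC.
    rewrite (weak_integration_by_parts _ _ _ _ wf wU1).
    by congr (- _); apply: eq_Rintegral => t _; exact: mulrC.
  rewrite -RintegralTZ; last exact: iM.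
  rewrite -RintegralTB; [|exact: iM|by apply: integrableTZ; exact: iM].
  apply: ae_eq_RintegralT.
  - by apply: integrableT_measurable; exact: iM.
  - by apply: integrableT_measurable; apply: integrableTB;
      [exact: iM|apply: integrableTZ; exact: iM].
  - by apply: (ae_imp _ _ gE) => t {}gE /gE ->; ring.
have D1 := dual _ _ _ _ wr wr1 sp pE; have D2 := dual _ _ _ _ ws ws1 sq qE.
have iUp := iM _ _ cU sp; have iUq := iM _ _ cU sq.
have iVr := iM _ _ cV sr; have iVs := iM _ _ cV ss.
have iUr := iM _ _ cU sr; have iUs := iM _ _ cU ss.
(* Real part of the mean of the equation times x - i y. *)
have main : 2 * pi * a * (x ^+ 2 + y ^+ 2) =
    eps * (x * (\intT (fun t => U t * q t) - \intT (fun t => V t * s t)) -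
           y * (\intT (fun t => U t * p t) - \intT (fun t => V t * r t))).
  pose c1 := a * x + (b + beta / eps) * y; pose c2 := a * y - (b + beta / eps) * x.
  transitivity (\intT (fun t => (c1 * p t + c2 * q t) + a * (x ^+ 2 + y ^+ 2))).
    rewrite RintegralTD; [|by apply: integrableTD; exact: integrableTZ|exact: integrableT_cst].
    rewrite RintegralTD; [|exact: integrableTZ|exact: integrableTZ].
    rewrite (RintegralTZ _ _ ip) (RintegralTZ _ _ iq) p0 q0 !mulr0 !add0r.
    by rewrite Rintegral_period_cst mulrA.
  (* [L] collects the terms whose factors have mean zero, [N] the coupling with [U] and [V]. The
     terms in which [U] or [V] multiplies x y cancel between the two equations. *)
  pose L t := nu * x * p2 t + nu * y * q2 t +
    (eps * beta * x * s t - eps * beta * y * r t).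
  pose N t := eps * (x * (U t * q t - V t * s t) - y * (U t * p t - V t * r t)).
  have iL : integrableT L.
    by apply: integrableTD; [apply: integrableTD|apply: integrableTB]; exact: integrableTZ.
  have iN : integrableT N.
    by apply: integrableTZ; apply: integrableTB; apply: integrableTZ; exact: integrableTB.
  have L0 : \intT L = 0.
    rewrite /L RintegralTD; last 2 first.
    - by apply: integrableTD; exact: integrableTZ.
    - by apply: integrableTB; exact: integrableTZ.
    rewrite RintegralTD; [|exact: integrableTZ|exact: integrableTZ].
    rewrite RintegralTB; [|exact: integrableTZ|exact: integrableTZ].
    rewrite (RintegralTZ _ _ ip2) (RintegralTZ _ _ iq2).
    by rewrite (RintegralTZ _ _ ir) (RintegralTZ _ _ is') p20 q20 r0 s0 !mulr0 subr0 !addr0.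
  transitivity (\intT (fun t => L t + N t)).
    apply: ae_eq_RintegralT.
    - apply: integrableT_measurable; apply: integrableTD; last exact: integrableT_cst.
      by apply: integrableTD; exact: integrableTZ.
    - by apply: integrableT_measurable; exact: integrableTD.
    - apply: (ae_imp _ _ E) => t {}E /E [].
      move=> /(congr1 (fun z => z * x)) /= e1 /(congr1 (fun z => z * y)) /= e2.
      by move: e1 e2; rewrite /L /N /c1 /c2 /= => e1 e2; lra.
  rewrite RintegralTD// L0 add0r /N RintegralTZ; last first.
    by apply: integrableTB; apply: integrableTZ; exact: integrableTB.
  rewrite RintegralTB; [|by apply: integrableTZ; exact: integrableTB
    |by apply: integrableTZ; exact: integrableTB].
  rewrite (RintegralTZ x) ?(RintegralTZ y); [|exact: integrableTB|exact: integrableTB].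
  by rewrite (RintegralTB _ _ iUq iVs) (RintegralTB _ _ iUp iVr).
rewrite main D1 D2.
(* The integrals with [V] cancel exactly. *)
have -> : eps * (x * (\intT (fun t => V t * s t) - eps ^+ 2 * \intT (fun t => U t * s t) -
      \intT (fun t => V t * s t)) -
    y * (\intT (fun t => V t * r t) - eps ^+ 2 * \intT (fun t => U t * r t) -
      \intT (fun t => V t * r t))) =
  eps ^+ 3 * (y * \intT (fun t => U t * r t) - x * \intT (fun t => U t * s t)) by ring.
rewrite -mulrA ler_pM2l ?exprn_gt0//.
rewrite -(RintegralTZ y _ iUr) -(RintegralTZ x _ iUs) -RintegralTB;
  [|exact: integrableTZ|exact: integrableTZ].
have [_ irr] := sr; have [_ iss] := ss.
have -> : 2 * pi * (x ^+ 2 + y ^+ 2) = \intT (fun=> x ^+ 2 + y ^+ 2).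
  by rewrite Rintegral_period_cst.
have iH := integrableTD _ _ irr iss.
rewrite -(RintegralTD _ _ irr iss) -(RintegralTD _ _ (integrableT_cst _) iH).
have iS := integrableTD _ _ (integrableT_cst (x ^+ 2 + y ^+ 2)) iH.
rewrite -(RintegralTZ _ _ iS).
apply: ae_le_RintegralT.
- by apply: integrableTB; exact: integrableTZ.
- exact: integrableTZ.
- apply: aeW => t /UM UMt.
  have h (c d : R) : c * (U t * d) <= M / 2 * (c ^+ 2 + d ^+ 2).
    rewrite mulrCA; apply: le_trans (ler_norm _) _; rewrite normrM -mulrA.
    rewrite ler_pM// ler_norml; apply/andP; split.
      by have := sqr_ge0 (c + d); lra.
    by have := sqr_ge0 (c - d); lra.
  have := h y (r t); have := h (- x) (s t); rewrite sqrrN; lra.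
Qed.

End Energy.

(** * Real and imaginary parts of L^2 functions *)

Section Eigenfunction.
Context {R : realType}.
Implicit Types (p : R -> R) (f : R -> R[i]).
Notation mu := (@lebesgue_measure R).
Notation "\intT p" := (\int[mu]_(y in period) p y) (at level 10, p at level 9).

(** The pushforward under the translation has the right value on half-open intervals, so uniqueness
    of Lebesgue measure identifies it. *)
Lemma lebesgue_measure_preimage_addr (c : R) (A : set (measurableTypeR R)) :
  measurable A -> mu ((fun y => y + c) @^-1` A) = mu A.
Proof.
move=> mA.
have mshift : measurable_fun setT
    ((fun y => y + c) : measurableTypeR R -> measurableTypeR R).
  by apply: measurable_funD => //; exact: measurable_cst.
pose nu : {measure set (measurableTypeR R) -> \bar R} :=
  
  measure_function_pushforward__canonical__measure_function_Measure mu mshift.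
rewrite [RHS](@lebesgue_measure_unique _ nu)//.
move=> X /ocitvP [->|[[a b] /= ab ->]].
  by rewrite !measure0.
rewrite /nu /= /pushforward /=.
have -> : (fun y => y + c) @^-1` `]a, b]%classic = `]a - c, b - c]%classic.
  apply/seteqP; split=> y /=; rewrite !in_itv /= => /andP[h1 h2];
    apply/andP; split; lra.
rewrite !lebesgue_measure_itv /= !lte_fin ltrD2r ab -!EFinB; congr EFin; ring.
Qed.

Lemma negligible_preimage_addr (c : R) (A : set (measurableTypeR R)) :
  mu.-negligible A -> mu.-negligible ((fun y => y + c) @^-1` A).
Proof.
move=> [B [mB B0 AB]]; exists ((fun y => y + c) @^-1` B); split.
- rewrite -[X in measurable X]setTI.
  by apply: measurable_funD => //; exact: measurable_cst.
- by rewrite lebesgue_measure_preimage_addr.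
- by move=> y /AB.
Qed.

Lemma periodic2piMn (V : Type) (f : R -> V) (n : nat) (y : R) :
  periodic2pi f -> f (y + 2 * pi *+ n) = f y.
Proof.
move=> pf; elim: n => [|n IH]; first by rewrite mulr0n addr0.
by rewrite mulrSr addrA pf.
Qed.

(** The exceptional set on the line is covered by the translates of a null set by multiples of 2 pi,
    a countable union. *)
Lemma periodic_ae_eq0 f : periodic2pi f ->
  {ae mu, forall y, period y -> f y = 0} -> eq_ae f (fun=> 0).
Proof.
move=> pf f0; pose N : set R := [set y | period y -> f y = 0].
have NN : mu.-negligible (~` N) by exact: f0.
pose F (n : nat) := (fun y : R => y + 2 * pi *+ n) @^-1` (~` N) `|`
  (fun y : R => y + - (2 * pi *+ n)) @^-1` (~` N).
have FN : mu.-negligible (\bigcup_n F n).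
  apply: negligible_bigcup => n.
  by apply: negligibleU; exact: negligible_preimage_addr.
apply: (negligibleS _ FN) => y fy0.
pose k := Num.floor (y / (2 * pi)).
have ky : period (y - k%:~R * (2 * pi)).
  have pi0 := @pi2_gt0 R; apply/periodE.
  have /andP[k1 k2] := floor_itv (y / (2 * pi)).
  move: k1 k2; rewrite -/k ler_pdivlMr// ltr_pdivrMr// intrD mulrDl mul1r.
  by move=> k1 k2; apply/andP; split; lra.
have notN z : period z -> f z = f y -> (~` N) z.
  by move=> pz fz Nz; apply: fy0; rewrite /= -fz; exact: Nz.
(* A nonnegative [k] moves [y] to the left; [Negz n] is -(n + 1), hence the move to the right by
   [n.+1] periods. *)
move: ky; case: (k) => n.
  rewrite -[Posz n]/(n%:Z) -pmulrn (mulr_natl (2 * pi) n) => ky.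
  exists n => //; right; apply: notN => //.
  by rewrite -[in RHS](subrK (2 * pi *+ n) y) periodic2piMn.
rewrite NegzE mulrNz -pmulrn mulNr opprK (mulr_natl (2 * pi) n.+1) => ky.
by exists n.+1 => //; left; apply: notN => //; rewrite periodic2piMn.
Qed.

Lemma ae_eq0_of_sqr p : sqintegrable p -> \intT (fun y => p y ^+ 2) <= 0 ->
  {ae mu, forall y, period y -> p y = 0}.
Proof.
move=> [mp ip2] p0.
have E : (\int[mu]_(y in period) `|(p y ^+ 2)%:E| = 0)%E.
  have -> : (\int[mu]_(y in period) `|(p y ^+ 2)%:E| =
      \int[mu]_(y in period) (p y ^+ 2)%:E)%E.
    by apply: eq_integral => y _; rewrite gee0_abs// lee_fin sqr_ge0.
  rewrite -[LHS]fineK; last exact: (integrable_fin_num measurable_period ip2).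
  congr EFin; apply/eqP; rewrite eq_le [X in X && _]p0 /=.
  by apply: Rintegral_ge0 => y _; exact: sqr_ge0.
have mp2 : measurable_fun period (fun y => (p y ^+ 2)%:E).
  by case/integrableP: ip2.
have := (ae_eq_integral_abs mu measurable_period mp2).1 E.
move=> /ae_imp; apply=> y + py => /(_ py) /= [] /eqP.
by rewrite sqrf_eq0 => /eqP.
Qed.

Lemma integrable_sqmod f : L2T f -> integrableT (fun y => sqmod (f y)).
Proof.
move=> [_ mRe mIm foo]; apply/integrableP; split.
  apply/measurable_EFinP; apply: measurable_funTS.
  by apply: measurable_funD; exact: measurable_funX.
under eq_integral => y _ do rewrite gee0_abs ?lee_fin ?addr_ge0 ?sqr_ge0//.
exact: foo.
Qed.

Lemma sqintegrable_Re f : L2T f -> sqintegrable (fun y => complex.Re (f y)).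
Proof.
move=> Lf; have isq := integrable_sqmod _ Lf; have [_ mRe _ _] := Lf.
split; first exact: measurable_funTS.
apply: (le_integrable measurable_period _ _ isq).
  by apply/measurable_EFinP; apply: measurable_funTS; exact: measurable_funX.
by move=> y _ /=; rewrite lee_fin !ger0_norm ?addr_ge0 ?sqr_ge0// lerDl sqr_ge0.
Qed.

Lemma sqintegrable_Im f : L2T f -> sqintegrable (fun y => complex.Im (f y)).
Proof.
move=> Lf; have isq := integrable_sqmod _ Lf; have [_ _ mIm _] := Lf.
split; first exact: measurable_funTS.
apply: (le_integrable measurable_period _ _ isq).
  by apply/measurable_EFinP; apply: measurable_funTS; exact: measurable_funX.
by move=> y _ /=; rewrite lee_fin !ger0_norm ?addr_ge0 ?sqr_ge0// lerDr sqr_ge0.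
Qed.

Lemma weakly_derivable_Re (f f1 : R -> R[i]) : L2T f -> L2T f1 -> weak_derivative f f1 ->
  weakly_derivable (fun y => complex.Re (f y)) (fun y => complex.Re (f1 y)).
Proof.
move=> Lf Lf1 wf; split; [exact: sqintegrable_Re|exact: sqintegrable_Re|].
move=> phi /wf /(congr1 (@complex.Re R)) /= e.
transitivity (\int[mu]_(y in period) complex.Re (f y * (derive1 phi y)%:C%C)).
  by apply: eq_Rintegral => y _; case: (f y) => u v /=; rewrite mulr0 subr0.
rewrite e; congr (- _).
by apply: eq_Rintegral => y _; case: (f1 y) => u v /=; rewrite mulr0 subr0.
Qed.

Lemma weakly_derivable_Im (f f1 : R -> R[i]) : L2T f -> L2T f1 -> weak_derivative f f1 ->
  weakly_derivable (fun y => complex.Im (f y)) (fun y => complex.Im (f1 y)).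
Proof.
move=> Lf Lf1 wf; split; [exact: sqintegrable_Im|exact: sqintegrable_Im|].
move=> phi /wf /(congr1 (@complex.Im R)) /= e.
transitivity (\int[mu]_(y in period) complex.Im (f y * (derive1 phi y)%:C%C)).
  by apply: eq_Rintegral => y _; case: (f y) => u v /=; rewrite mulr0 add0r.
rewrite e; congr (- _).
by apply: eq_Rintegral => y _; case: (f1 y) => u v /=; rewrite mulr0 add0r.
Qed.

(** The product with a test function is again periodic and C^1, so its derivative has mean zero.
    This brings the profile [U] into the weak calculus. *)
Lemma weakly_derivable_C1T (phi : R -> R) : C1T phi ->
  weakly_derivable phi (derive1 phi).
Proof.
move=> Cphi; have [pphi dphi cdphi] := Cphi.
have cphi := derivable_continuous _ dphi.
split; [exact: continuous_sqintegrable|exact: continuous_sqintegrable|].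
move=> chi Cchi; have [pchi dchi cdchi] := Cchi.
have cchi := derivable_continuous _ dchi.
have e : derive1 (fun y => phi y * chi y) =
    fun y => phi y * derive1 chi y + derive1 phi y * chi y.
  apply/funext => y; rewrite !derive1E deriveM//.
  by congr (_ + _); exact: mulrC.
have C : C1T (fun y => phi y * chi y).
  split; first by move=> y; rewrite pphi pchi.
    by move=> y; exact: derivableM.
  rewrite e => y; apply: cvgD; apply: cvgM;
    [exact: cphi|exact: cdchi|exact: cdphi|exact: cchi].
have := Rintegral_derive1 _ C; rewrite e RintegralTD; last 2 first.
- by apply: sqintegrable_mul; exact: continuous_sqintegrable.
- by apply: sqintegrable_mul; exact: continuous_sqintegrable.
by move=> /eqP; rewrite addr_eq0 => /eqP.
Qed.

End Eigenfunction.

(** * Sign of the eigenvalue from the real system *)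

Section RealEigenvalueEquation.
Context {R : realType}.
Implicit Types (p : R -> R) (f : R -> R[i]).
Notation mu := (@lebesgue_measure R).
Notation "\intT p" := (\int[mu]_(y in period) p y) (at level 10, p at level 9).

Lemma Rintegral_period_mean p : integrableT p ->
  \intT (fun y => p y - (2 * pi)^-1 * \intT p) = 0.
Proof.
move=> ip; rewrite RintegralTB ?Rintegral_period_cst//; last exact: integrableT_cst.
by rewrite mulrA divff ?mul1r ?subrr// gt_eqF// pi2_gt0.
Qed.

(** As [h2] has mean zero, the mean of [h] is minus the mean of [f] divided by eps^2; the added
    constant compensates it. *)
Lemma helmholtz_mean (eps : R) (f h h1 h2 : R -> R) : 0 < eps ->
  weakly_derivable h h1 -> weakly_derivable h1 h2 -> sqintegrable f ->
  {ae mu, forall y, period y -> f y = h2 y - eps ^+ 2 * h y} ->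
  \intT (fun y => h y + ((2 * pi)^-1 * \intT f) / eps ^+ 2) = 0.
Proof.
move=> eps0 wh wh1 sf fE; have [sh _ _] := wh; have [_ sh2 _] := wh1.
have ih := sqintegrable_integrable _ sh; have ih2 := sqintegrable_integrable _ sh2.
have e : \intT f = - (eps ^+ 2 * \intT h).
  rewrite -[RHS]add0r -(weak_derivative_mean0 _ _ wh1) -(RintegralTZ _ _ ih).
  rewrite -RintegralTB//; last exact: integrableTZ.
  apply: ae_eq_RintegralT => //; first by case: sf.
  by apply: integrableT_measurable; apply: integrableTB => //; exact: integrableTZ.
rewrite RintegralTD//; last exact: integrableT_cst.
have eps_neq0 : eps != 0 by rewrite gt_eqF.
rewrite Rintegral_period_cst e; move: (2 * pi) (lt0r_neq0 (@pi2_gt0 R)) => c c_neq0.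
by field; rewrite c_neq0 eps_neq0.
Qed.

(** Here a0 + i b0 is the eigenvalue, fr + i fi the eigenfunction f, and hr + i hi is (dyy -
    eps^2)^-1 f. The first smallness condition serves the energy bound, the second compares the
    eps^3 estimate with nu eps^2. The second alternative is that f vanishes. *)
Lemma Re_eigenvalue_lt0 (a0 b0 nu eps beta M : R)
    (U U1 V fr fr1 fr2 fi fi1 fi2 hr hr1 hr2 hi hi1 hi2 : R -> R) :
  0 < eps <= 1 -> 0 < beta -> 0 < M -> 0 < nu -> `|b0 - beta / eps| <= nu / 2 ->
  eps * (nu / 2 + M + (M + beta) * (1 + (2 * pi) ^+ 4) / 2) <= beta / 4 ->
  eps * (M / 2 * (2 * pi + (2 * pi) ^+ 4 * (16 * pi * M ^+ 2 / beta ^+ 2))) < 2 * pi * nu ->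
  weakly_derivable U U1 -> weakly_derivable U1 V ->
  continuous U -> continuous V ->
  (forall t, period t -> `|U t| <= M) -> (forall t, period t -> `|V t| <= M) ->
  weakly_derivable fr fr1 -> weakly_derivable fr1 fr2 ->
  weakly_derivable fi fi1 -> weakly_derivable fi1 fi2 ->
  weakly_derivable hr hr1 -> weakly_derivable hr1 hr2 ->
  weakly_derivable hi hi1 -> weakly_derivable hi1 hi2 ->
  {ae mu, forall t, period t -> fr t = hr2 t - eps ^+ 2 * hr t} ->
  {ae mu, forall t, period t -> fi t = hi2 t - eps ^+ 2 * hi t} ->
  {ae mu, forall t, period t ->
    a0 * fr t - b0 * fi t = nu * (fr2 t - eps ^+ 2 * fr t) +
      eps * (U t * fi t - (V t - beta) * hi t) /\
    a0 * fi t + b0 * fr t = nu * (fi2 t - eps ^+ 2 * fi t) -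
      eps * (U t * fr t - (V t - beta) * hr t)} ->
  a0 < 0 \/ {ae mu, forall t, period t -> fr t = 0 /\ fi t = 0}.
Proof.
move=> eps01 beta0 M0 nu0 hb he1 he2 wU wU1 cU cV UM VM wfr wfr1 wfi wfi1
  whr whr1 whi whi1 frE fiE E.
have /andP[eps0 eps1] := eps01.
have [sfr _ _] := wfr; have [_ sfr2 _] := wfr1.
have [sfi _ _] := wfi; have [_ sfi2 _] := wfi1.
pose x := (2 * pi)^-1 * \intT fr; pose y := (2 * pi)^-1 * \intT fi.
pose p t := fr t - x; pose q t := fi t - y.
pose r t := hr t + x / eps ^+ 2; pose s t := hi t + y / eps ^+ 2.
have wp : weakly_derivable p fr1 := weakly_derivableBc _ _ x wfr.
have wq : weakly_derivable q fi1 := weakly_derivableBc _ _ y wfi.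
have rB : r = fun t => hr t - - (x / eps ^+ 2) by apply/funext => t; rewrite opprK.
have sB : s = fun t => hi t - - (y / eps ^+ 2) by apply/funext => t; rewrite opprK.
have wr : weakly_derivable r hr1 by rewrite rB; exact: weakly_derivableBc.
have ws : weakly_derivable s hi1 by rewrite sB; exact: weakly_derivableBc.
have [sp _ _] := wp; have [sq _ _] := wq; have [sr _ _] := wr; have [ss _ _] := ws.
have p0 : \intT p = 0 := Rintegral_period_mean _ (sqintegrable_integrable _ sfr).
have q0 : \intT q = 0 := Rintegral_period_mean _ (sqintegrable_integrable _ sfi).
have r0 : \intT r = 0 := helmholtz_mean _ _ _ _ _ eps0 whr whr1 sfr frE.
have s0 : \intT s = 0 := helmholtz_mean _ _ _ _ _ eps0 whi whi1 sfi fiE.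
have eps_neq0 : eps != 0 by rewrite gt_eqF.
have pE : {ae mu, forall t, period t -> p t = hr2 t - eps ^+ 2 * r t}.
  by apply: (ae_imp _ _ frE) => t {}frE /frE; rewrite /p /r => ->; field.
have qE : {ae mu, forall t, period t -> q t = hi2 t - eps ^+ 2 * s t}.
  by apply: (ae_imp _ _ fiE) => t {}fiE /fiE; rewrite /q /s => ->; field.
pose a := a0 + nu * eps ^+ 2; pose b := b0 - beta / eps.
(* The means -x / eps^2 and -y / eps^2 of [hr] and [hi] produce the terms with eps^-1 V and the
   shift of b0 by beta / eps. *)
have {}E : {ae mu, forall t, period t ->
    a * (p t + x) - b * (q t + y) - beta / eps * q t =
      nu * fr2 t + eps * (U t * q t + U t * y - (V t - beta) * s t)
      + eps^-1 * V t * y /\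
    a * (q t + y) + b * (p t + x) + beta / eps * p t =
      nu * fi2 t - eps * (U t * p t + U t * x - (V t - beta) * r t)
      - eps^-1 * V t * x}.
  apply: (ae_imp _ _ E) => t {}E /E [E1 E2]; rewrite /p /q /r /s /a /b; split.
    transitivity (a0 * fr t - b0 * fi t + nu * eps ^+ 2 * fr t + beta / eps * y).
      by ring.
    by rewrite E1; field.
  transitivity (a0 * fi t + b0 * fr t + nu * eps ^+ 2 * fi t - beta / eps * x).
    by ring.
  by rewrite E2; field.
have ibp : \intT (fun t => fr2 t * q t) = \intT (fun t => fi2 t * p t).
  have comm (u v : R -> R) : \intT (fun t => u t * v t) = \intT (fun t => v t * u t).
    by apply: eq_Rintegral => t _; exact: mulrC.
  rewrite comm (weak_integration_by_parts _ _ _ _ wq wfr1).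
  by rewrite [RHS]comm (weak_integration_by_parts _ _ _ _ wp wfi1) comm.
have rp := helmholtz_bound _ _ _ _ _ wr whr1 r0 sp pE.
have sq' := helmholtz_bound _ _ _ _ _ ws whi1 s0 sq qE.
have hb' : - (nu / 2) <= b by move: hb; rewrite ler_norml => /andP[].
have EB := energy_bound _ _ _ _ _ _ _ _ _ _ _ _ _ _ _ _ eps01 beta0 M0 hb' he1 nu0
  UM VM sp sq sfr2 sfi2 sr ss p0 q0 ibp rp sq' E.
have MB := mean_bound _ _ _ _ _ _ _ _ _ _ _ _ _ _ _ _ _ _ _ _ _ eps0 M0 wU wU1 cU cV UM
  sp sq sfr2 sfi2 wr whr1 ws whi1 p0 q0 (weak_derivative_mean0 _ _ wfr1)
  (weak_derivative_mean0 _ _ wfi1) r0 s0 pE qE E.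
move: EB MB rp sq'.
set C := 16 * pi * M ^+ 2 / beta ^+ 2 in he2 *.
set X := x ^+ 2 + y ^+ 2.
set Ip := \intT (fun t => p t ^+ 2); set Iq := \intT (fun t => q t ^+ 2).
set Ir := \intT (fun t => r t ^+ 2); set Is := \intT (fun t => s t ^+ 2).
set K : R := (2 * pi) ^+ 4 in he2 * => EB MB rp sq'.
have pi0 := @pi2_gt0 R.
have K0 : 0 <= K by rewrite /K exprn_ge0 ?ltW.
have X0 : 0 <= X by rewrite addr_ge0// sqr_ge0.
move: (X0); rewrite le_eqVlt => /predU1P[X0'|Xgt0].
  (* If the mean of f is zero, the energy bound kills its mean-free part too. *)
  right; have [xy0 yy0] : x = 0 /\ y = 0.
    move/esym/eqP: X0'; rewrite /X paddr_eq0 ?sqr_ge0// !sqrf_eq0.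
    by case/andP => /eqP ? /eqP ?.
  have Ip0 : 0 <= Ip by apply: Rintegral_ge0 => t _; exact: sqr_ge0.
  have Iq0 : 0 <= Iq by apply: Rintegral_ge0 => t _; exact: sqr_ge0.
  rewrite -X0' mulr0 in EB.
  have pz : {ae mu, forall t, period t -> p t = 0}.
    by apply: ae_eq0_of_sqr => //; apply: le_trans EB; rewrite lerDl.
  have qz : {ae mu, forall t, period t -> q t = 0}.
    by apply: ae_eq0_of_sqr => //; apply: le_trans EB; rewrite lerDr.
  apply: (ae_imp _ _ (ae_and _ _ pz qz)) => t [{}pz {}qz] pt.
  by move: (pz pt) (qz pt); rewrite /p /q xy0 yy0 !subr0.
left; have rs : Ir + Is <= K * (C * X).
  apply: (@le_trans _ _ (K * (Ip + Iq))); first by rewrite mulrDr lerD.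
  by rewrite ler_wpM2l.
have h : 2 * pi * a * X <= eps ^+ 3 * (M / 2) * (2 * pi * X + K * (C * X)).
  apply: le_trans MB _; rewrite ler_wpM2l//; last by rewrite lerD2l.
  by rewrite mulr_ge0 ?exprn_ge0 ?divr_ge0 ?ltW.
have {}h : 2 * pi * a <= eps ^+ 3 * (M / 2) * (2 * pi + K * C).
  rewrite -(ler_pM2r Xgt0); apply: le_trans h _.
  by rewrite le_eqVlt; apply/orP; left; apply/eqP; ring.
(* The second smallness condition multiplied by eps^2. *)
have h2 : eps ^+ 3 * (M / 2) * (2 * pi + K * C) < 2 * pi * nu * eps ^+ 2.
  have -> : eps ^+ 3 * (M / 2) * (2 * pi + K * C) =
    eps * (M / 2 * (2 * pi + K * C)) * eps ^+ 2 by ring.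
  by rewrite ltr_pM2r ?exprn_gt0.
have : 2 * pi * a0 < 0.
  have -> : 2 * pi * a0 = 2 * pi * a - 2 * pi * nu * eps ^+ 2 by rewrite /a; ring.
  by rewrite subr_lt0; exact: le_lt_trans h h2.
by rewrite pmulr_rlt0.
Qed.

End RealEigenvalueEquation.

(** * Smallness of epsilon and conclusion *)

Theorem mainTheorem3 (R : realType) (U : R -> R) (beta nu : R)
  (hU : C2T U)
  (hU0 : \int[@lebesgue_measure R]_(y in period) U y = 0)
  (hbeta : 0 < beta) (hnu : 0 < nu) :
  \forall eps \near (0 : R)^'+,
    forall lam : R[i], principal_eigenvalue U nu eps beta lam ->
      complex.Re lam < 0.
Proof.
have [C1U C1U1] := hU; have [_ dU _] := C1U; have [_ dU1 cV] := C1U1.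
have cU := derivable_continuous _ dU.
have wU := weakly_derivable_C1T _ C1U; have wU1 := weakly_derivable_C1T _ C1U1.
have [M1 [M10 UM1]] := continuous_bounded_period _ cU.
have [M2 [M20 VM2]] := continuous_bounded_period _ cV.
pose M := M1 + M2.
have M0 : 0 < M by rewrite addr_gt0.
have UM t : period t -> `|U t| <= M.
  by move=> /UM1 /le_trans; apply; rewrite lerDl ltW.
have VM t : period t -> `|derive1 (derive1 U) t| <= M.
  by move=> /VM2 /le_trans; apply; rewrite lerDr ltW.
(* [K1] and [K2] are the coefficients of [eps] in the two smallness conditions of
   [Re_eigenvalue_lt0]. *)
pose K1 := nu / 2 + M + (M + beta) * (1 + (2 * pi) ^+ 4) / 2.
pose K2 := M / 2 * (2 * pi + (2 * pi) ^+ 4 * (16 * pi * M ^+ 2 / beta ^+ 2)).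
have pi0 := pi_gt0 R.
have pi4_gt0 : 0 < (2 * pi) ^+ 4 :> R by rewrite exprn_gt0// mulr_gt0.
have Mb0 : 0 < M + beta by rewrite addr_gt0.
have K10 : 0 < K1.
  apply: addr_gt0; first by apply: addr_gt0 => //; exact: divr_gt0.
  apply: divr_gt0 => //; apply: mulr_gt0 => //; exact: addr_gt0.
have K20 : 0 < K2.
  apply: mulr_gt0; first exact: divr_gt0.
  apply: addr_gt0; first exact: mulr_gt0.
  apply: mulr_gt0 => //; apply: divr_gt0; last exact: exprn_gt0.
  by apply: mulr_gt0; [exact: mulr_gt0|exact: exprn_gt0].
(* Simplicity supplies the eigenfunction [f], and the spectral clause places [lam] in the disc. Here
   [h] is (dyy - eps^2) f and [phi] is (dyy - eps^2)^-1 f. *)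
near=> eps => lam [specE [f [f_neq0 [_ [h [phi [fh phif eqn]]]] _]]].
have eps0 : 0 < eps by near: eps; exact: nbhs_right_gt.
have eps1 : eps <= 1 by near: eps; apply: nbhs_right_le.
have he1 : eps * K1 <= beta / 4.
  rewrite -ler_pdivlMr//; near: eps; apply: nbhs_right_le.
  by apply: divr_gt0 => //; exact: divr_gt0.
have he2 : eps * K2 < 2 * pi * nu.
  rewrite -ltr_pdivlMr//; near: eps; apply: nbhs_right_lt.
  by apply: divr_gt0 => //; apply: mulr_gt0 => //; exact: mulr_gt0.
(* The imaginary part of [lam] minus the centre of the disc is at most its modulus. *)
have hb : `|complex.Im lam - beta / eps| <= nu / 2.
  have : (spectrum (Lop U nu eps beta) `&` principal_disc nu eps beta) lam.
    by rewrite specE.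
  move=> [_]; rewrite /principal_disc /=; set z := lam - _.
  rewrite normc_def ltcE /= => /andP[_ zlt]; apply/ltW; apply: le_lt_trans zlt.
  have -> : complex.Im lam - beta / eps = complex.Im z by rewrite /z; case: (lam).
  rewrite -sqrtr_sqr; apply: ler_wsqrtr; by rewrite lerDr sqr_ge0.
have [Lh [f2 [f1 [Lf Lf1 Lf2 wf wf1]] hE]] := fh.
have [_ [phi2 [phi1 [Lphi Lphi1 Lphi2 wphi wphi1]] fE]] := phif.
have eps01 : 0 < eps <= 1 by rewrite eps0.
have frE : {ae @lebesgue_measure R, forall t, period t ->
    complex.Re (f t) = complex.Re (phi2 t) - eps ^+ 2 * complex.Re (phi t)}.
  apply: (ae_imp _ _ fE) => t -> _.
  by case: (phi2 t) (phi t) => [u v] [u' v'] /=; ring.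
have fiE : {ae @lebesgue_measure R, forall t, period t ->
    complex.Im (f t) = complex.Im (phi2 t) - eps ^+ 2 * complex.Im (phi t)}.
  apply: (ae_imp _ _ fE) => t -> _.
  by case: (phi2 t) (phi t) => [u v] [u' v'] /=; ring.
have E : {ae @lebesgue_measure R, forall t, period t ->
    complex.Re lam * complex.Re (f t) - complex.Im lam * complex.Im (f t) =
      nu * (complex.Re (f2 t) - eps ^+ 2 * complex.Re (f t)) +
      eps * (U t * complex.Im (f t) -
        (derive1 (derive1 U) t - beta) * complex.Im (phi t)) /\
    complex.Re lam * complex.Im (f t) + complex.Im lam * complex.Re (f t) =
      nu * (complex.Im (f2 t) - eps ^+ 2 * complex.Im (f t)) -
      eps * (U t * complex.Re (f t) -
        (derive1 (derive1 U) t - beta) * complex.Re (phi t))}.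
  apply: (ae_imp _ _ (ae_and _ _ hE eqn)) => t [-> +] _.
  rewrite -[derive1n 2 U]/(derive1 (derive1 U)).
  move: (U t) (derive1 (derive1 U) t) => Ut Vt.
  case: (lam) (f t) (f2 t) (phi t) => [l1 l2] [u1 v1] [u2 v2] [u3 v3] /= [e1 e2].
  by split; lra.
have [//|fz] := Re_eigenvalue_lt0 _ _ _ _ _ _ _ _ _ _ _ _ _ _ _ _ _ _ _ _ _
  eps01 hbeta M0 hnu hb he1 he2 wU wU1 cU cV UM VM
  (weakly_derivable_Re _ _ Lf Lf1 wf) (weakly_derivable_Re _ _ Lf1 Lf2 wf1)
  (weakly_derivable_Im _ _ Lf Lf1 wf) (weakly_derivable_Im _ _ Lf1 Lf2 wf1)
  (weakly_derivable_Re _ _ Lphi Lphi1 wphi) (weakly_derivable_Re _ _ Lphi1 Lphi2 wphi1)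
  (weakly_derivable_Im _ _ Lphi Lphi1 wphi) (weakly_derivable_Im _ _ Lphi1 Lphi2 wphi1)
  frE fiE E.
(* Vanishing on one period propagates by periodicity and contradicts that [f] is an
   eigenfunction. *)
have [pf _ _ _] := Lf; case: f_neq0; apply: periodic_ae_eq0 => //.
apply: (ae_imp _ _ fz) => t {}fz /fz.
by case: (f t) => u v /= [-> ->].
Unshelve. all: by end_near. Qed.
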